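(* Let $q>0$, $q\neq1$, and let $\mathcal{A}=\mathcal{U}_q(su(2))$ be the unital $*$-algebra generated by $E,F,K,K^{-1}$ with defining relations $KK^{-1}=K^{-1}K=\mathbf 1$, $KEK^{-1}=q^2E$, $KFK^{-1}=q^{-2}F$, $EF-FE=\frac{K-K^{-1}}{q-q^{-1}}$ and involution $E^*=FK$, $F^*=K^{-1}E$, $K^*=K$, with the $\mathbb{Z}$-grading determined by $E\in\mathcal{A}_1$, $F\in\mathcal{A}_{-1}$, $K,K^{-1}\in\mathcal{A}_0$. There exists a $*$-representation $\pi$ of $\mathcal{A}$ which has no well-behaved extension in a possibly larger Hilbert space; that is, there is no well-behaved $*$-representation $\tilde\pi$ of $\mathcal{A}$ on a Hilbert space $\mathcal{H}_{\tilde\pi}$ containing $\mathcal{H}_\pi$ as a Hilbert subspace such that $\mathcal{D}(\pi)\subseteq\mathcal{D}(\tilde\pi)$ and $\tilde\pi(x)\varphi=\pi(x)\varphi$ for all $x\in\mathcal{A}$, $\varphi\in\mathcal{D}(\pi)$.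
   Context: **$*$-representations.** A $*$-representation $\pi$ of a $*$-algebra $\mathcal{A}$ on a dense linear subspace $\mathcal{D}(\pi)$ of a Hilbert space $\mathcal{H}_\pi$ is an algebra homomorphism from $\mathcal{A}$ into the algebra of linear operators $\mathcal{D}(\pi)\to\mathcal{D}(\pi)$ with $\langle\pi(x)\varphi,\psi\rangle=\langle\varphi,\pi(x^* )\psi\rangle$ for $\varphi,\psi\in\mathcal{D}(\pi)$, $x\in\mathcal{A}$. The graph topology on $\mathcal{D}(\pi)$ is the locally convex topology given by the norms $\varphi\mapsto\|\varphi\|+\|\pi(x)\varphi\|$, $x\in\mathcal{A}$. $\pi$ is closed if $\mathcal{D}(\pi)$ is complete in the graph topology. **Partial action.** $\mathcal{B}:=\mathcal{A}_0$ is commutative. $\widehat{\mathcal{B}}$ is the set of characters (nonzero $*$-homomorphisms $\mathcal{B}\to\mathbb{C}$), with the weak topology defined by the functions $\widehat b(\chi)=\chi(b)$, $b\in\mathcal B$, and the Borel structure generated by the open sets. $\widehat{\mathcal{B}}^+$ is the set of $\chi\in\widehat{\mathcal{B}}$ with $\chi(c^*c)\ge0$ for all homogeneous $c\in\bigcup_n\mathcal{A}_n$. For $n\in\mathbb{Z}$, $\mathcal{D}_{-n}$ is the set of $\chi\in\widehat{\mathcal{B}}^+$ with $\chi(c^*c)\neq0$ for some $c\in\mathcal{A}_n$, and $\alpha_n:\mathcal{D}_{-n}\to\mathcal{D}_n$ is $(\alpha_n(\chi))(b)=\chi(c^*bc)/\chi(c^*c)$, $b\in\mathcal{B}$, for any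 such $c$ (independent of the choice). **Well-behaved.** A closed $*$-representation $\pi$ of $\mathcal{A}$ is well-behaved if: (i) the restriction of $\pi$ to $\mathcal{B}$ is integrable (i.e. $\overline{\pi(b)}$ is normal for every $b\in\mathcal{B}$) and there is a spectral measure $E_\pi$ on $\widehat{\mathcal{B}}^+$ with $\overline{\pi(b)}=\int_{\widehat{\mathcal{B}}^+}\widehat b(\chi)\,dE_\pi(\chi)$ for $b\in\mathcal{B}$; (ii) for all $n\in\mathbb{Z}$, $c\in\mathcal{A}_n$ and Borel $\Delta\subseteq\widehat{\mathcal{B}}^+$, $\pi(c)E_\pi(\Delta)\supseteq E_\pi(\alpha_n(\Delta\cap\mathcal{D}_{-n}))\pi(c)$. *)

(* Defs.v *)
From HB Require Import structures.
From mathcomp Require Import all_boot all_order all_algebra.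
From mathcomp Require Import generic_quotient sesquilinear complex.
From mathcomp Require Import all_classical all_reals all_analysis.

Set Implicit Arguments.
Unset Strict Implicit.
Unset Printing Implicit Defensive.

Import Order.TTheory GRing.Theory Num.Theory.
Import numFieldNormedType.Exports.

Local Open Scope classical_set_scope.
Local Open Scope quotient_scope.
Local Open Scope ring_scope.

(** * Z-graded *-algebras *)

Record gradedStarAlg (R : realType) := GradedStarAlg {
  gsa_alg :> algType R[i];
  invol : gsa_alg -> gsa_alg;
  involK : involutive invol;
  involD : {morph invol : x y / x + y};
  involZ : forall (a : R[i]) x, invol (a *: x) = a^* *: invol x;
  involM : forall x y, invol (x * y) = invol y * invol x;
  grade : int -> set gsa_alg;
  grade_lin : forall n (a : R[i]) x y,
    grade n x -> grade n y -> grade n (a *: x + y);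
  grade1 : grade 0 1;
  gradeM : forall m n x y, grade m x -> grade n y -> grade (m + n) (x * y);
  grade_invol : forall n x, grade n x -> grade (- n) (invol x);
  grade_span : forall x, exists2 s : seq gsa_alg,
    forall y, y \in s -> exists n, grade n y & x = \sum_(y <- s) y;
  grade_direct : forall (s : seq int) (f : int -> gsa_alg), uniq s ->
    (forall n, grade n (f n)) -> \sum_(n <- s) f n = 0 ->
    forall n, n \in s -> f n = 0
}.

Arguments invol {R} _ _.
Arguments grade {R} _ _.

Section BaseAlgebra.
Variables (R : realType) (A : gradedStarAlg R).

Definition deg0 : {pred A} := fun x => `[< grade A 0 x >].

Lemma deg0P x : reflect (grade A 0 x) (x \in deg0).
Proof. exact: asboolP. Qed.

Lemma deg0_subalg_closed : subalg_closed deg0.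
Proof.
split.
- exact/deg0P/grade1.
- move=> a x y /deg0P xA /deg0P yA; exact/deg0P/grade_lin.
- move=> x y /deg0P xA /deg0P yA; apply/deg0P; rewrite -[0%R]addr0; exact: gradeM.
Qed.

HB.instance Definition _ :=
  GRing.isSubalgClosed.Build R[i] A deg0 deg0_subalg_closed.

Definition baseAlg := {x : A | x \in deg0}.
HB.instance Definition _ := SubChoice.on baseAlg.
HB.instance Definition _ := [SubChoice_isSubAlgebra of baseAlg by <:].

End BaseAlgebra.

(** * Characters and the partial action *)

Section Characters.
Variables (R : realType) (A : gradedStarAlg R).
Local Notation B := (baseAlg A).

Lemma deg0_invol (b : B) : invol A (val b) \in @deg0 R A.
Proof. by apply/deg0P; rewrite -oppr0; apply: grade_invol; exact/deg0P/(valP b). Qed.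

Definition base_invol (b : B) : B := Sub (invol A (val b)) (deg0_invol b).

Lemma deg0_sandwich n c (cn : grade A n c) (b : B) :
  invol A c * val b * c \in @deg0 R A.
Proof.
apply/deg0P; rewrite -(addNr n) -[- n]addr0; apply: gradeM => //.
by apply: gradeM; [exact: grade_invol | exact/deg0P/(valP b)].
Qed.

Lemma deg0_square n c (cn : grade A n c) : invol A c * c \in @deg0 R A.
Proof. by apply/deg0P; rewrite -(addNr n); apply: gradeM => //; exact: grade_invol. Qed.

(* [c^* b c] and [c^* c] as elements of the degree-0 part, for homogeneous c *)
Definition sandwich n c (cn : grade A n c) (b : B) : B :=
  Sub (invol A c * val b * c) (deg0_sandwich cn b).
Definition square n c (cn : grade A n c) : B :=
  Sub (invol A c * c) (deg0_square cn).

Definition is_char (chi : B -> R[i]) : Prop :=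
  [/\ forall (a : R[i]) x y, chi (a *: x + y) = a * chi x + chi y,
      forall x y, chi (x * y) = chi x * chi y,
      forall x, chi (base_invol x) = (chi x)^*
    & exists x, chi x != 0].

Definition Bhat : set (B -> R[i]) := [set chi | is_char chi].

Definition Bhat_pos : set (B -> R[i]) :=
  [set chi | Bhat chi /\ forall n c (cn : grade A n c), 0 <= chi (square cn)].

(* the domain of alpha_n, usually written D_{-n} *)
Definition act_dom (n : int) : set (B -> R[i]) :=
  [set chi | Bhat_pos chi /\ exists c (cn : grade A n c), chi (square cn) != 0].

(* the graph of alpha_n : D_{-n} -> D_n *)
Definition alpha (n : int) (chi psi : B -> R[i]) : Prop :=
  act_dom n chi /\
  exists c (cn : grade A n c), chi (square cn) != 0 /\
    psi = (fun b => chi (sandwich cn b) / chi (square cn)).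

Definition alpha_image (n : int) (D : set (B -> R[i])) : set (B -> R[i]) :=
  [set psi | exists2 chi, (D `&` act_dom n) chi & alpha n chi psi].

(* Functions [B -> C] with the Borel sigma-algebra of [Bhat_pos], whose topology
   is the trace of the topology of pointwise convergence (the weak topology of
   the functions [chi |-> chi b]).  In [subspace Bhat_pos] the points outside
   [Bhat_pos] are isolated, so [Bhat_pos] is measurable and its measurable
   subsets are exactly its Borel sets; a pointed carrier is needed for a
   [measurableType]. *)
Definition char_space : Type :=
  g_sigma_algebraType
    (@open (subspace (Bhat_pos : set {ptws B -> (R[i])^o}))).
HB.instance Definition _ := Measurable.on char_space.

End Characters.

Arguments Bhat {R} _ _.
Arguments Bhat_pos {R} _ _.

(** * Hilbert spaces and unbounded operators *)

(* The form is linear in its first argument; completeness is the one of the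
   norm, which [hdotE] ties to the inner product. *)
Record hilbertSpace (R : realType) := HilbertSpace {
  hcarrier :> completeNormedModType R[i];
  hdot : {dot hcarrier for @Num.conj R[i]};
  hdotE : forall x : hcarrier, `|x| ^+ 2 = hdot x x
}.
Arguments hdot {R} _.

Section Operators.
Variables (R : realType) (H : hilbertSpace R).
Local Notation "'[ u , v ]" := (hdot H u v) : ring_scope.

(* Unbounded operators are represented by their graphs. *)
Implicit Types S T : set (H * H).

Definition op_dom T : set H := [set u | exists v, T (u, v)].

Definition op_adj T : set (H * H) :=
  [set p | forall u v, T (u, v) -> '[v, p.1] = '[u, p.2]].

Definition op_comp S T : set (H * H) :=
  [set p | exists2 w, T (p.1, w) & S (w, p.2)].

Record normal_op T : Prop := NormalOp {
  normal_lin : forall (a : R[i]) u v u' v', T (u, v) -> T (u', v') ->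
    T (a *: u + u', a *: v + v');
  normal_fun : forall u v w, T (u, v) -> T (u, w) -> v = w;
  normal_dense : dense (op_dom T);
  normal_closed : closed T;
  normal_comm : op_comp (op_adj T) T = op_comp T (op_adj T)
}.

Record spectral_measure d (X : measurableType d) (E : set X -> H -> H) : Prop :=
  SpectralMeasure {
  spectral_lin : forall D, measurable D -> linear (E D);
  spectral_idem : forall D, measurable D -> idempotent_fun (E D);
  spectral_sa : forall D, measurable D -> forall u v, '[E D u, v] = '[u, E D v];
  spectralT : forall u, E setT u = u;
  spectral_sigma : forall D : nat -> set X, (forall k, measurable (D k)) ->
    trivIset setT D ->
    forall u, (fun n => \sum_(k < n) E (D k) u) @ \oo --> E (\bigcup_k D k) u
}.

Section SpectralIntegral.
Variables (d : measure_display) (X : measurableType d) (E : set X -> H -> H).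

Definition spectral_pre (u : H) (D : set X) : \bar R :=
  (complex.Re '[E D u, u])%:E.

Definition cintegral (mu : set X -> \bar R) (f : X -> R[i]) : R[i] :=
  (fine (integral mu setT (fun x => (complex.Re (f x))%:E)) +i*
   fine (integral mu setT (fun x => (complex.Im (f x))%:E)))%C.

(* integral of f against the complex measure D |-> <E(D)u, v>, by polarization *)
Definition sesq_integral (f : X -> R[i]) (u v : H) : R[i] :=
  4%:R^-1 * \sum_(k < 4)
    'i ^+ k * cintegral (spectral_pre (u + 'i ^+ k *: v)) f.

Definition spectral_dom (f : X -> R[i]) : set H :=
  [set u | (integral (spectral_pre u) setT
              (fun x => (complex.Re (`|f x| ^+ 2))%:E) < +oo)%E].

(* the graph of the operator \int f dE *)
Definition spectral_integral (f : X -> R[i]) : set (H * H) :=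
  [set p | spectral_dom f p.1 /\
     forall v, spectral_dom f v -> '[p.2, v] = sesq_integral f p.1 v].

End SpectralIntegral.
End Operators.

(** * *-representations *)

(* Representations of a unital *-algebra are unital ([rep1]): otherwise the zero
   representation would be one. *)
Record starRep (R : realType) (A : gradedStarAlg R) (H : hilbertSpace R) :=
  StarRep {
  rep_dom : set H;
  (* only the values of [rep_act x] on [rep_dom] are meaningful *)
  rep_act :> A -> H -> H;
  rep_dom0 : rep_dom 0;
  rep_dom_lin : forall (a : R[i]) u v,
    rep_dom u -> rep_dom v -> rep_dom (a *: u + v);
  rep_dense : dense rep_dom;
  rep_stable : forall x u, rep_dom u -> rep_dom (rep_act x u);
  rep_lin : forall x (a : R[i]) u v, rep_dom u -> rep_dom v ->
    rep_act x (a *: u + v) = a *: rep_act x u + rep_act x v;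
  rep_linl : forall (a : R[i]) x y u, rep_dom u ->
    rep_act (a *: x + y) u = a *: rep_act x u + rep_act y u;
  rep1 : forall u, rep_dom u -> rep_act 1 u = u;
  repM : forall x y u, rep_dom u ->
    rep_act (x * y) u = rep_act x (rep_act y u);
  rep_star : forall x u v, rep_dom u -> rep_dom v ->
    hdot H (rep_act x u) v = hdot H u (rep_act (invol A x) v)
}.

Section Representations.
Variables (R : realType) (A : gradedStarAlg R) (H : hilbertSpace R).
Variable (pi : starRep A H).
Local Notation D := (rep_dom pi).

(* completeness of the domain in the graph topology *)
Definition rep_closed : Prop :=
  forall F : set_system H, ProperFilter F -> F D ->
  (forall (x : A) (e : R[i]), 0 < e ->
     \forall u & v \near F, `|u - v| + `|pi x (u - v)| < e) ->
  exists2 u, D u & forall (x : A) (e : R[i]), 0 < e ->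
     \forall v \near F, `|u - v| + `|pi x (u - v)| < e.

Definition rep_graph (x : A) : set (H * H) :=
  [set p | D p.1 /\ p.2 = pi x p.1].

Definition op_bar (x : A) : set (H * H) := closure (rep_graph x).

Definition integrable_base : Prop :=
  forall b : baseAlg A, normal_op (op_bar (val b)).

(* [E] is a spectral measure on [Bhat_pos] with [op_bar b = \int b^ dE] *)
Definition represents_base (E : set (char_space A) -> H -> H) : Prop :=
  [/\ spectral_measure E,
      forall u, E (Bhat_pos A) u = u
    & forall b : baseAlg A,
        op_bar (val b) = spectral_integral E (fun chi : char_space A => chi b)].

Definition well_behaved : Prop :=
  [/\ rep_closed,
      integrable_base
    & exists E : set (char_space A) -> H -> H,
        represents_base E /\
        forall n c, grade A n c ->
        forall Delta : set (char_space A), measurable Delta ->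
          Delta `<=` Bhat_pos A ->
        forall u, D u ->
          D (E Delta u) /\ pi c (E Delta u) = E (alpha_image n Delta) (pi c u)].

End Representations.

Definition rep_extends (R : realType) (A : gradedStarAlg R)
    (H K : hilbertSpace R) (J : H -> K) (pi : starRep A H) (rho : starRep A K) :=
  forall u, rep_dom pi u ->
    rep_dom rho (J u) /\ forall x, rho x (J u) = J (pi x u).

(** * The quantized enveloping algebra U_q(su(2)) *)

(* Terms of the free unital algebra on E, F, K, K^{-1}; [uq_eq] is the
   congruence generated by the axioms of unital algebras and the defining
   relations, and [uq] the quotient. *)
Inductive uq_term (C : Type) : Type :=
| TE | TF | TK | TKi
| TConst of C
| TAdd of uq_term C & uq_term C
| TMul of uq_term C & uq_term C.

Arguments TE {C}. Arguments TF {C}. Arguments TK {C}. Arguments TKi {C}.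

HB.instance Definition _ (C : Type) := gen_eqMixin (uq_term C).
HB.instance Definition _ (C : Type) := gen_choiceMixin (uq_term C).

Section Uq.
Variables (R : realType) (q : R).
Local Notation term := (uq_term R[i]).
Local Notation "s ⊕ t" := (TAdd s t) (at level 50, left associativity).
Local Notation "s ⊗ t" := (TMul s t) (at level 40, left associativity).
Local Notation "'K_ a" := (TConst a) (at level 8, a at level 2, format "''K_' a").

Inductive uq_eq : term -> term -> Prop :=
| uq_refl t : uq_eq t t
| uq_sym s t : uq_eq s t -> uq_eq t s
| uq_trans s t u : uq_eq s t -> uq_eq t u -> uq_eq s u
| uq_congD s s' t t' : uq_eq s s' -> uq_eq t t' -> uq_eq (s ⊕ t) (s' ⊕ t')
| uq_congM s s' t t' : uq_eq s s' -> uq_eq t t' -> uq_eq (s ⊗ t) (s' ⊗ t')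
| uq_addA s t u : uq_eq (s ⊕ (t ⊕ u)) (s ⊕ t ⊕ u)
| uq_addC s t : uq_eq (s ⊕ t) (t ⊕ s)
| uq_add0 t : uq_eq ('K_0 ⊕ t) t
| uq_mulA s t u : uq_eq (s ⊗ (t ⊗ u)) (s ⊗ t ⊗ u)
| uq_mul0 t : uq_eq ('K_0 ⊗ t) 'K_0
| uq_mul1 t : uq_eq ('K_1 ⊗ t) t
| uq_mulDl s t u : uq_eq ((s ⊕ t) ⊗ u) (s ⊗ u ⊕ t ⊗ u)
| uq_mulDr s t u : uq_eq (s ⊗ (t ⊕ u)) (s ⊗ t ⊕ s ⊗ u)
| uq_constD a b : uq_eq ('K_a ⊕ 'K_b) 'K_(a + b)
| uq_constM a b : uq_eq ('K_a ⊗ 'K_b) 'K_(a * b)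
| uq_constC a t : uq_eq ('K_a ⊗ t) (t ⊗ 'K_a)
| uq_KKi : uq_eq (TK ⊗ TKi) 'K_1
| uq_KiK : uq_eq (TKi ⊗ TK) 'K_1
| uq_KE : uq_eq (TK ⊗ TE ⊗ TKi) ('K_((q ^+ 2)%:C)%C ⊗ TE)
| uq_KF : uq_eq (TK ⊗ TF ⊗ TKi) ('K_((q ^- 2)%:C)%C ⊗ TF)
| uq_EF : uq_eq (TE ⊗ TF ⊕ 'K_(-1) ⊗ (TF ⊗ TE))
                ('K_(((q - q^-1)^-1)%:C)%C ⊗ (TK ⊕ 'K_(-1) ⊗ TKi)).

Definition uq_eqb : rel term := fun s t => `[< uq_eq s t >].

Lemma uq_eqb_refl : reflexive uq_eqb.
Proof. by move=> t; apply/asboolP; exact: uq_refl. Qed.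
Lemma uq_eqb_sym : symmetric uq_eqb.
Proof. by move=> s t; apply/asboolP/asboolP; exact: uq_sym. Qed.
Lemma uq_eqb_trans : transitive uq_eqb.
Proof.
by move=> t s u /asboolP st /asboolP tu; apply/asboolP; exact: uq_trans st tu.
Qed.
Canonical uq_equiv := EquivRel uq_eqb uq_eqb_refl uq_eqb_sym uq_eqb_trans.

Definition uq := {eq_quot uq_equiv}.
HB.instance Definition _ := Choice.on uq.

Definition uq_pi (t : term) : uq := \pi_uq t.

Lemma uq_piP s t : uq_pi s = uq_pi t <-> uq_eq s t.
Proof.
split=> [/eqmodP /asboolP //|st]; apply/eqmodP; exact/asboolP.
Qed.

Lemma uq_surj (x : uq) : exists t, x = uq_pi t.
Proof. by exists (repr x); rewrite /uq_pi reprK. Qed.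

Lemma uq_reprP t : uq_eq (repr (uq_pi t)) t.
Proof. by apply/uq_piP; rewrite /uq_pi reprK. Qed.

Definition uq_add (x y : uq) : uq := uq_pi (repr x ⊕ repr y).
Definition uq_mul (x y : uq) : uq := uq_pi (repr x ⊗ repr y).
Definition uq_const (a : R[i]) : uq := uq_pi 'K_a.
Definition uq_opp (x : uq) : uq := uq_mul (uq_const (-1)) x.
Definition uq_scale (a : R[i]) (x : uq) : uq := uq_mul (uq_const a) x.

Lemma uq_addE s t : uq_add (uq_pi s) (uq_pi t) = uq_pi (s ⊕ t).
Proof. by apply/uq_piP; apply: uq_congD; exact: uq_reprP. Qed.
Lemma uq_mulE s t : uq_mul (uq_pi s) (uq_pi t) = uq_pi (s ⊗ t).
Proof. by apply/uq_piP; apply: uq_congM; exact: uq_reprP. Qed.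

Local Ltac by_terms :=
  repeat (let x := fresh "x" in move=> x;
          try (let t := fresh "t" in have [t ->] := uq_surj x; clear x));
  rewrite /uq_scale /uq_opp /uq_const ?(uq_addE, uq_mulE).

Lemma uq_addrA : associative uq_add.
Proof. by by_terms; apply/uq_piP; exact: uq_addA. Qed.
Lemma uq_addrC : commutative uq_add.
Proof. by by_terms; apply/uq_piP; exact: uq_addC. Qed.
Lemma uq_add0r : left_id (uq_const 0) uq_add.
Proof. by by_terms; apply/uq_piP; exact: uq_add0. Qed.
Lemma uq_mulrA : associative uq_mul.
Proof. by by_terms; apply/uq_piP; exact: uq_mulA. Qed.
Lemma uq_mul1r : left_id (uq_const 1) uq_mul.
Proof. by by_terms; apply/uq_piP; exact: uq_mul1. Qed.
Lemma uq_mulDrl : left_distributive uq_mul uq_add.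
Proof. by by_terms; apply/uq_piP; exact: uq_mulDl. Qed.
Lemma uq_mulDrr : right_distributive uq_mul uq_add.
Proof. by by_terms; apply/uq_piP; exact: uq_mulDr. Qed.
Lemma uq_constDE a b : uq_add (uq_const a) (uq_const b) = uq_const (a + b).
Proof. by by_terms; apply/uq_piP; exact: uq_constD. Qed.
Lemma uq_constME a b : uq_mul (uq_const a) (uq_const b) = uq_const (a * b).
Proof. by by_terms; apply/uq_piP; exact: uq_constM. Qed.
Lemma uq_const_comm a x : uq_mul (uq_const a) x = uq_mul x (uq_const a).
Proof. by move: x; by_terms; apply/uq_piP; exact: uq_constC. Qed.
Lemma uq_mul0r x : uq_mul (uq_const 0) x = uq_const 0.
Proof. by move: x; by_terms; apply/uq_piP; exact: uq_mul0. Qed.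
Lemma uq_mulr1 : right_id (uq_const 1) uq_mul.
Proof. by move=> x; rewrite -uq_const_comm uq_mul1r. Qed.
Lemma uq_addNr : left_inverse (uq_const 0) uq_opp uq_add.
Proof.
move=> x; rewrite /uq_opp -[X in uq_add _ X]uq_mul1r -uq_mulDrl uq_constDE.
by rewrite addNr uq_mul0r.
Qed.

Section Eval.
Variables (A : algType R[i]) (e f k ki : A).

Fixpoint uq_eval (t : term) : A :=
  match t with
  | TE => e | TF => f | TK => k | TKi => ki
  | 'K_a => a%:A
  | s ⊕ t => uq_eval s + uq_eval t
  | s ⊗ t => uq_eval s * uq_eval t
  end.

Definition uq_rel : Prop :=
  [/\ k * ki = 1 /\ ki * k = 1,
      k * e * ki = ((q ^+ 2)%:C)%C *: e,
      k * f * ki = ((q ^- 2)%:C)%C *: f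
    & e * f - f * e = (((q - q^-1)^-1)%:C)%C *: (k - ki)].

Lemma uq_evalP s t : uq_rel -> uq_eq s t -> uq_eval s = uq_eval t.
Proof.
move=> [[r1 r2] r3 r4 r5]; elim=> //=.
- by move=> {}s {}t u _ -> _ ->.
- by move=> {}s s' {}t t' _ -> _ ->.
- by move=> {}s s' {}t t' _ -> _ ->.
- by move=> *; rewrite addrA.
- by move=> *; rewrite addrC.
- by move=> *; rewrite scale0r add0r.
- by move=> *; rewrite mulrA.
- by move=> *; rewrite scale0r mul0r.
- by move=> *; rewrite scale1r mul1r.
- by move=> *; rewrite mulrDl.
- by move=> *; rewrite mulrDr.
- by move=> *; rewrite scalerDl.
- by move=> *; rewrite -scalerAl mul1r scalerA.
- by move=> *; rewrite -scalerAl -scalerAr mul1r mulr1.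
- by rewrite scale1r.
- by rewrite scale1r.
- by rewrite r3 -scalerAl mul1r.
- by rewrite r4 -scalerAl mul1r.
- by rewrite -!scalerAl !mul1r !scaleN1r r5.
Qed.

End Eval.

Lemma uq_const_neq : uq_const 1 != uq_const 0.
Proof.
apply/eqP => /uq_piP.
move=> /(@uq_evalP (R[i])^o 0 0 1 1) /= H.
have /H : @uq_rel (R[i])^o 0 0 1 1.
  by split; rewrite ?(mulr0, mul0r, mulr1, scaler0, subrr).
by rewrite scale0r scale1r; apply/eqP; rewrite oner_eq0.
Qed.

HB.instance Definition _ := GRing.isZmodule.Build uq
  uq_addrA uq_addrC uq_add0r uq_addNr.
HB.instance Definition _ := GRing.Zmodule_isNzRing.Build uq
  uq_mulrA uq_mul1r uq_mulr1 uq_mulDrl uq_mulDrr uq_const_neq.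

Lemma uq_scalerA a b x : uq_scale a (uq_scale b x) = uq_scale (a * b) x.
Proof. by rewrite /uq_scale uq_mulrA uq_constME. Qed.
Lemma uq_scale1r : left_id 1 uq_scale.
Proof. exact: uq_mul1r. Qed.
Lemma uq_scalerDr : right_distributive uq_scale +%R.
Proof. by move=> a x y; exact: uq_mulDrr. Qed.
Lemma uq_scalerDl x : {morph uq_scale^~ x : a b / a + b}.
Proof.
by move=> a b /=; rewrite /uq_scale -uq_constDE; exact: uq_mulDrl.
Qed.
HB.instance Definition _ := GRing.Zmodule_isLmodule.Build R[i] uq
  uq_scalerA uq_scale1r uq_scalerDr uq_scalerDl.
Lemma uq_scalerAl (a : R[i]) (x y : uq) : a *: (x * y) = (a *: x) * y.
Proof. exact: uq_mulrA. Qed.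
HB.instance Definition _ := GRing.Lmodule_isLalgebra.Build R[i] uq uq_scalerAl.
Lemma uq_scalerAr (a : R[i]) (x y : uq) : a *: (x * y) = x * (a *: y).
Proof.
rewrite /GRing.scale /= /uq_scale uq_const_comm -[LHS]uq_mulrA.
by congr uq_mul; rewrite -uq_const_comm.
Qed.
HB.instance Definition _ := GRing.Lalgebra_isAlgebra.Build R[i] uq uq_scalerAr.

Definition uqE : uq := uq_pi TE.
Definition uqF : uq := uq_pi TF.
Definition uqK : uq := uq_pi TK.
Definition uqKi : uq := uq_pi TKi.

Lemma uq_piD s t : uq_pi (s ⊕ t) = uq_pi s + uq_pi t.
Proof. by rewrite -uq_addE. Qed.
Lemma uq_piM s t : uq_pi (s ⊗ t) = uq_pi s * uq_pi t.
Proof. by rewrite -uq_mulE. Qed.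
Lemma uq_piC a : uq_pi 'K_a = a%:A.
Proof. by rewrite -[LHS]mulr1. Qed.

Lemma uq_evalE t : uq_eval uqE uqF uqK uqKi t = uq_pi t.
Proof.
elim: t => //= [a|s -> t ->|s -> t ->]; by rewrite ?uq_piC ?uq_piD ?uq_piM.
Qed.

Lemma uq_relP : uq_rel uqE uqF uqK uqKi.
Proof.
have P s t : uq_eq s t ->
    uq_eval uqE uqF uqK uqKi s = uq_eval uqE uqF uqK uqKi t.
  by move=> st; rewrite !uq_evalE; exact/uq_piP.
split; first split.
- by have /= := P _ _ uq_KKi; rewrite scale1r.
- by have /= := P _ _ uq_KiK; rewrite scale1r.
- by have /= := P _ _ uq_KE; rewrite -scalerAl mul1r.
- by have /= := P _ _ uq_KF; rewrite -scalerAl mul1r.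
- by have /= := P _ _ uq_EF; rewrite -!scalerAl !mul1r !scaleN1r.
Qed.

Lemma uq_ind (P : uq -> Prop) : P uqE -> P uqF -> P uqK -> P uqKi ->
  (forall a, P a%:A) -> (forall x y, P x -> P y -> P (x + y)) ->
  (forall x y, P x -> P y -> P (x * y)) -> forall x, P x.
Proof.
move=> PE PF PK PKi PC PD PM x; have [t ->] := uq_surj x.
elim: t => //= [a|s Ps t Pt|s Ps t Pt].
- by rewrite uq_piC.
- by rewrite uq_piD; exact: PD.
- by rewrite uq_piM; exact: PM.
Qed.

(* the algebra morphism from [uq] induced by elements satisfying [uq_rel] *)
Section Lift.
Variables (A : algType R[i]) (e f k ki : A).
Hypothesis rel : uq_rel e f k ki.

Definition uq_lift (x : uq) : A := uq_eval e f k ki (repr x).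

Lemma uq_lift_pi t : uq_lift (uq_pi t) = uq_eval e f k ki t.
Proof. by apply: uq_evalP => //; exact: uq_reprP. Qed.

Lemma uq_liftD : {morph uq_lift : x y / x + y}.
Proof.
move=> x y; have [s ->] := uq_surj x; have [t ->] := uq_surj y.
by rewrite -uq_piD !uq_lift_pi.
Qed.
Lemma uq_liftM : {morph uq_lift : x y / x * y}.
Proof.
move=> x y; have [s ->] := uq_surj x; have [t ->] := uq_surj y.
by rewrite -uq_piM !uq_lift_pi.
Qed.
Lemma uq_liftC a : uq_lift a%:A = a%:A.
Proof. by rewrite -uq_piC uq_lift_pi. Qed.
Lemma uq_liftZ a x : uq_lift (a *: x) = a *: uq_lift x.
Proof. by rewrite -[x in LHS]mul1r scalerAl uq_liftM uq_liftC -scalerAl mul1r. Qed.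
End Lift.

(* the involution: E^* = FK, F^* = K^{-1}E, K^* = K *)
Fixpoint term_star (t : term) : term :=
  match t with
  | TE => TF ⊗ TK | TF => TKi ⊗ TE | TK => TK | TKi => TKi
  | 'K_a => 'K_(a^*)
  | s ⊕ t => term_star s ⊕ term_star t
  | s ⊗ t => term_star t ⊗ term_star s
  end.

Definition uq_star (x : uq) : uq := uq_pi (term_star (repr x)).


Lemma conj_realC (x : R) : ((x%:C)%C : R[i])^* = (x%:C)%C.
Proof. exact: conjc_real. Qed.

Lemma uq_KiEK : uqKi * uqE * uqK = ((q ^- 2)%:C)%C *: uqE.
Proof.
have [[r1 r2] r3 r4 r5] := uq_relP.
have [q0|q0] := eqVneq q 0.
  suff -> : uqE = 0 by rewrite mulr0 mul0r scaler0.
  have -> : uqE = uqKi * (uqK * uqE * uqKi) * uqK.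
    by rewrite !mulrA r2 mul1r -mulrA r2 mulr1.
  by rewrite r3 q0 expr0n /= scale0r mulr0 mul0r.
have {1}-> : uqE = ((q ^- 2)%:C)%C *: (uqK * uqE * uqKi).
  by rewrite r3 scalerA -rmorphM /= mulVf ?scale1r// expf_eq0.
rewrite -scalerAr -scalerAl; congr (_ *: _).
by rewrite !mulrA r2 mul1r -mulrA r2 mulr1.
Qed.

Lemma uq_KiFK : uqKi * uqF * uqK = ((q ^+ 2)%:C)%C *: uqF.
Proof.
have [[r1 r2] r3 r4 r5] := uq_relP.
have [q0|q0] := eqVneq q 0.
  suff -> : uqF = 0 by rewrite mulr0 mul0r scaler0.
  have -> : uqF = uqKi * (uqK * uqF * uqKi) * uqK.
    by rewrite !mulrA r2 mul1r -mulrA r2 mulr1.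
  by rewrite r4 q0 expr0n /= invr0 scale0r mulr0 mul0r.
have {1}-> : uqF = ((q ^+ 2)%:C)%C *: (uqK * uqF * uqKi).
  by rewrite r4 scalerA -rmorphM /= mulfV ?scale1r// expf_eq0.
rewrite -scalerAr -scalerAl; congr (_ *: _).
by rewrite !mulrA r2 mul1r -mulrA r2 mulr1.
Qed.

Lemma uq_KiEFK : uqKi * uqE * (uqF * uqK) = uqE * uqF.
Proof.
have [[r1 r2] r3 r4 r5] := uq_relP.
have -> : uqKi * uqE * (uqF * uqK) = (uqKi * uqE * uqK) * (uqKi * uqF * uqK).
  by rewrite -!mulrA [uqK * (uqKi * _)]mulrA r1 mul1r.
rewrite uq_KiEK uq_KiFK -scalerAl -scalerAr scalerA -rmorphM /=.
have [q0|q0] := eqVneq q 0; last first.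
  by rewrite mulVf ?scale1r// expf_eq0.
have -> : uqE = uqK * (uqKi * uqE * uqK) * uqKi.
  by rewrite !mulrA r1 mul1r -mulrA r1 mulr1.
by rewrite uq_KiEK q0 expr0n /= invr0 !scale0r !(mulr0, mul0r) scaler0.
Qed.

Lemma uq_starP s t : uq_eq s t -> uq_pi (term_star s) = uq_pi (term_star t).
Proof.
have [[r1 r2] r3 r4 r5] := uq_relP.
elim=> /=.
- by [].
- by [].
- by move=> {}s {}t u _ -> _ ->.
- by move=> {}s s' {}t t' _ H1 _ H2; rewrite !uq_piD H1 H2.
- by move=> {}s s' {}t t' _ H1 _ H2; rewrite !uq_piM H1 H2.
- by move=> *; rewrite !uq_piD addrA.
- by move=> *; rewrite !uq_piD addrC.
- by move=> *; rewrite !uq_piD uq_piC conjC0 scale0r add0r.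
- by move=> *; rewrite !uq_piM mulrA.
- by move=> *; rewrite !uq_piM uq_piC conjC0 scale0r mulr0.
- by move=> *; rewrite !uq_piM uq_piC conjC1 scale1r mulr1.
- by move=> *; rewrite !(uq_piD, uq_piM) mulrDr.
- by move=> *; rewrite !(uq_piD, uq_piM) mulrDl.
- by move=> *; rewrite uq_piD !uq_piC rmorphD scalerDl.
- by move=> *; rewrite uq_piM !uq_piC rmorphM -scalerAr mulr1 scalerA.
- by move=> *; rewrite !uq_piM !uq_piC -scalerAl -scalerAr mul1r mulr1.
- by rewrite uq_piM -/uqK -/uqKi r2 uq_piC conjC1 scale1r.
- by rewrite uq_piM -/uqK -/uqKi r1 uq_piC conjC1 scale1r.
- rewrite !uq_piM uq_piC -/uqK -/uqKi -/uqF conj_realC -scalerAr mulr1.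
  by rewrite !mulrA uq_KiFK -scalerAl.
- rewrite !uq_piM uq_piC -/uqK -/uqKi -/uqE conj_realC -scalerAr mulr1.
  by rewrite uq_KiEK -scalerAr.
- rewrite !(uq_piD, uq_piM) !uq_piC -/uqK -/uqKi -/uqE -/uqF conj_realC.
  rewrite -!scalerAr !mulr1 rmorphN1 !scaleN1r -r5 uq_KiEFK.
  by rewrite -!mulrA [uqK * (_ * _)]mulrA r1 mul1r.
Qed.

Lemma uq_star_pi t : uq_star (uq_pi t) = uq_pi (term_star t).
Proof. by apply: uq_starP; exact: uq_reprP. Qed.

Lemma uq_starD : {morph uq_star : x y / x + y}.
Proof.
move=> x y; have [s ->] := uq_surj x; have [t ->] := uq_surj y.
by rewrite -uq_piD !uq_star_pi /= uq_piD.
Qed.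
Lemma uq_starM x y : uq_star (x * y) = uq_star y * uq_star x.
Proof.
have [s ->] := uq_surj x; have [t ->] := uq_surj y.
by rewrite -uq_piM !uq_star_pi /= uq_piM.
Qed.
Lemma uq_starC (a : R[i]) : uq_star a%:A = a^*%:A.
Proof. by rewrite -!uq_piC uq_star_pi. Qed.
Lemma uq_starZ (a : R[i]) x : uq_star (a *: x) = a^* *: uq_star x.
Proof. by rewrite -[x in LHS]mul1r scalerAl uq_starM uq_starC -scalerAr mulr1. Qed.
Lemma uq_starE : uq_star uqE = uqF * uqK.
Proof. by rewrite uq_star_pi uq_piM. Qed.
Lemma uq_starF : uq_star uqF = uqKi * uqE.
Proof. by rewrite uq_star_pi uq_piM. Qed.
Lemma uq_starK : uq_star uqK = uqK.
Proof. by rewrite uq_star_pi. Qed.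
Lemma uq_starKi : uq_star uqKi = uqKi.
Proof. by rewrite uq_star_pi. Qed.

Lemma uq_star_inv : involutive uq_star.
Proof.
have [[r1 r2] _ _ _] := uq_relP.
elim/uq_ind => [||||a|x y hx hy|x y hx hy].
- by rewrite uq_starE uq_starM uq_starF uq_starK mulrA r1 mul1r.
- by rewrite uq_starF uq_starM uq_starE uq_starKi -mulrA r1 mulr1.
- by rewrite !uq_starK.
- by rewrite !uq_starKi.
- by rewrite !uq_starC conjCK.
- by rewrite !uq_starD hx hy.
- by rewrite !uq_starM hx hy.
Qed.

(* the grading determined by deg E = 1, deg F = -1, deg K = deg K^{-1} = 0 *)
Inductive uq_deg : int -> uq -> Prop :=
| deg_E : uq_deg 1 uqE
| deg_F : uq_deg (- 1) uqF
| deg_K : uq_deg 0 uqK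
| deg_Ki : uq_deg 0 uqKi
| deg_1 : uq_deg 0 1
| deg_0 n : uq_deg n 0
| deg_lin n (a : R[i]) x y : uq_deg n x -> uq_deg n y -> uq_deg n (a *: x + y)
| deg_mul m n x y : uq_deg m x -> uq_deg n y -> uq_deg (m + n) (x * y).

Lemma uq_degZ n (a : R[i]) x : uq_deg n x -> uq_deg n (a *: x).
Proof. by move=> dx; rewrite -[_ *: _]addr0; apply: deg_lin => //; exact: deg_0. Qed.

Lemma uq_deg_star n x : uq_deg n x -> uq_deg (- n) (uq_star x).
Proof.
have s0 : uq_star 0 = 0 by have := uq_starC 0; rewrite conjC0 !scale0r.
elim=> {n x} [||||||n a x y _ hx _ hy|m n x y _ hx _ hy].
- by rewrite uq_starE -(addr0 (- 1)); apply: deg_mul; [exact: deg_F | exact: deg_K].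
- by rewrite uq_starF opprK -(add0r 1); apply: deg_mul; [exact: deg_Ki | exact: deg_E].
- by rewrite uq_starK; exact: deg_K.
- by rewrite uq_starKi; exact: deg_Ki.
- by have := uq_starC 1; rewrite conjC1 !scale1r => ->; exact: deg_1.
- by move=> n; rewrite s0; exact: deg_0.
- by rewrite uq_starD uq_starZ; exact: deg_lin.
- by rewrite uq_starM opprD addrC; exact: deg_mul.
Qed.

Lemma uq_deg_span x : exists2 s : seq uq,
  forall y, y \in s -> exists n, uq_deg n y & x = \sum_(y <- s) y.
Proof.
have one n y : uq_deg n y -> exists2 s : seq uq,
    forall z, z \in s -> exists n, uq_deg n z & y = \sum_(z <- s) z.
  move=> dy; exists [:: y]; last by rewrite big_seq1.
  by move=> z; rewrite inE => /eqP ->; exists n.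
elim/uq_ind: x => [||||a|x y [s hs ->] [t ht ->]|x y [s hs ->] [t ht ->]].
- exact: one deg_E.
- exact: one deg_F.
- exact: one deg_K.
- exact: one deg_Ki.
- by apply: (one 0); apply: uq_degZ; exact: deg_1.
- exists (s ++ t); last by rewrite big_cat.
  by move=> z; rewrite mem_cat => /orP[/hs|/ht].
- exists [seq a * b | a <- s, b <- t]; last by rewrite big_allpairs_dep big_distrlr.
  move=> z /allpairsP[[a b] /= [/hs[m da] /ht[n db] ->]].
  by exists (m + n); exact: deg_mul.
Qed.

(* the gauge automorphism E |-> 2 E, F |-> 1/2 F acts on degree n by 2 ^ n *)
Lemma uq_gauge_rel : uq_rel (2 *: uqE) (2^-1 *: uqF) uqK uqKi.
Proof.
have [[r1 r2] r3 r4 r5] := uq_relP; split => //.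
- by rewrite -scalerAr -scalerAl r3 scalerA mulrC -scalerA.
- by rewrite -scalerAr -scalerAl r4 scalerA mulrC -scalerA.
- rewrite -!scalerAl -!scalerAr !scalerA mulfV ?pnatr_eq0//.
  by rewrite mulVf ?pnatr_eq0// !scale1r.
Qed.

Definition uq_gauge : uq -> uq := uq_lift (2 *: uqE) (2^-1 *: uqF) uqK uqKi.

Lemma uq_gaugeD : {morph uq_gauge : x y / x + y}.
Proof. exact: uq_liftD uq_gauge_rel. Qed.
Lemma uq_gaugeM : {morph uq_gauge : x y / x * y}.
Proof. exact: uq_liftM uq_gauge_rel. Qed.
Lemma uq_gaugeZ a x : uq_gauge (a *: x) = a *: uq_gauge x.
Proof. exact: (uq_liftZ uq_gauge_rel). Qed.
Lemma uq_gauge0 : uq_gauge 0 = 0.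
Proof. by have := uq_gaugeZ 0 0; rewrite !scale0r. Qed.

Lemma uq_gauge_deg n x : uq_deg n x -> uq_gauge x = (2 : R[i]) ^ n *: x.
Proof.
have gpi t : uq_gauge (uq_pi t) =
    uq_eval (2 *: uqE) (2^-1 *: uqF) uqK uqKi t.
  exact: (uq_lift_pi uq_gauge_rel).
elim=> {n x} [||||||n a x y _ hx _ hy|m n x y _ hx _ hy].
- by rewrite gpi expr1z.
- by rewrite gpi /= -exprN1.
- by rewrite gpi expr0z scale1r.
- by rewrite gpi expr0z scale1r.
- by rewrite expr0z scale1r; have := uq_liftC uq_gauge_rel 1; rewrite !scale1r.
- by move=> n; rewrite uq_gauge0 scaler0.
- by rewrite uq_gaugeD uq_gaugeZ hx hy scalerDr !scalerA mulrC.
- rewrite uq_gaugeM hx hy -scalerAl -scalerAr scalerA.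
  by rewrite expfzDr ?pnatr_eq0.
Qed.

Let exp2_inj : injective (exprz (2 : R[i])).
Proof.
have <- : (2%:C)%C = 2 :> R[i] by rewrite (rmorph_nat (real_complex R)).
move=> m n; rewrite -!(fmorphXz (real_complex R)) => /fmorph_inj.
by apply: ieexprIz; rewrite ?ltr0n// gt_eqF ?ltr1n.
Qed.

Lemma uq_deg_direct (s : seq int) (f : int -> uq) : uniq s ->
  (forall n, uq_deg n (f n)) -> \sum_(n <- s) f n = 0 ->
  forall n, n \in s -> f n = 0.
Proof.
have gsum (r : seq int) (g : int -> uq) :
    uq_gauge (\sum_(n <- r) g n) = \sum_(n <- r) uq_gauge (g n).
  exact: (big_morph uq_gauge uq_gaugeD uq_gauge0).
elim: s f => // m s IH f /= /andP[ms us] df; rewrite big_cons => S0.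
have S1 : \sum_(n <- s) ((2 : R[i]) ^ n - 2 ^ m) *: f n = 0.
  have : uq_gauge (f m + \sum_(n <- s) f n) = 0.
    by rewrite S0 uq_gauge0.
  rewrite uq_gaugeD (uq_gauge_deg (df m)) gsum.
  rewrite (eq_bigr (fun n => (2 : R[i]) ^ n *: f n)); last first.
    by move=> n _; exact: uq_gauge_deg.
  have -> : f m = - \sum_(n <- s) f n by apply/eqP; rewrite -addr_eq0 S0.
  rewrite scalerN scaler_sumr addrC -sumrB => sum0; rewrite -[RHS]sum0.
  by apply: eq_bigr => n _; rewrite scalerBl.
have Z n : n \in s -> f n = 0.
  move=> ns; have := IH _ us (fun n => uq_degZ _ (df n)) S1 n ns.
  move=> H; apply/eqP; move/eqP: H; apply: contraLR => fn0.
  apply/negP => /eqP /(congr1 (fun z => ((2 : R[i]) ^ n - 2 ^ m)^-1 *: z)).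
  have d0 : (2 : R[i]) ^ n - 2 ^ m != 0.
    by rewrite subr_eq0; apply: contraNneq ms => /exp2_inj <-.
  rewrite scalerA mulVf// scale1r scaler0 => f0; by rewrite f0 eqxx in fn0.
move=> n; rewrite inE => /predU1P[->|/Z//].
by move: S0; rewrite big_seq big1 ?addr0// => k; exact: Z.
Qed.

Definition Uq_su2 : gradedStarAlg R :=
  GradedStarAlg uq_star_inv uq_starD uq_starZ uq_starM
    deg_lin deg_1 deg_mul uq_deg_star uq_deg_span uq_deg_direct.

End Uq.

(* Main.v *)
Require Import Defs.
From HB Require Import structures.
From mathcomp Require Import all_boot all_order all_algebra.
From mathcomp Require Import complex.
From mathcomp Require Import all_classical all_reals all_analysis.
From mathcomp Require Import sesquilinear ring lra.

(** In a well-behaved representation the operator of [K] is diagonalized by a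
    spectral measure carried by the positive characters.  If [chi] is such a
    character with [chi K = x > 0], the numbers [chi ((E^n)^* E^n)] and
    [chi ((F^n)^* F^n)] are products of factors that are eventually negative;
    being nonnegative, both sequences must reach zero, and comparing the value
    of the Casimir element at the two zeros gives [x = q^k] with [k] an integer.
    Hence [(K - 1) (K - q)] is a positive operator in every well-behaved
    representation, although there is a representation in which [K] has an
    eigenvalue [kappa] strictly between 1 and [q].  The latter acts on the
    finitely supported vectors of [l2 (nat * nat)]: [E] is the sum of a weighted
    creation operator on the first index and a weighted annihilation operator
    on the second, and [F = E^* K^-1]. *)

Set Implicit Arguments.
Unset Strict Implicit.
Unset Printing Implicit Defensive.

Import Order.TTheory GRing.Theory Num.Theory.
Import numFieldNormedType.Exports.

Local Open Scope ring_scope.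

(** * The Casimir element and the positive characters *)

Lemma bernoulli_ineq (R : realDomainType) (a : R) n :
  0 <= a -> 1 + a *+ n <= (1 + a) ^+ n.
Proof.
move=> a0; elim: n => [|n IH]; first by rewrite mulr0n addr0.
rewrite exprS; apply: le_trans (ler_wpM2l _ IH); last by lra.
rewrite mulrDr mulr1 mulrDl mul1r mulrS addrA lerD2l.
by rewrite lerDl mulr_ge0// mulrn_wge0.
Qed.

(** One of [q] and [q^-1] exceeds 1, so one of the two summands grows without bound while the other
    stays positive. With [M] a multiple of the Casimir value, this yields a negative factor. *)
Lemma odd_powers_unbounded (R : archiRealFieldType) (q x M : R) :
  0 < q -> q != 1 -> 0 < x ->
  exists n, M < x * q ^+ n.*2.+1 + (x * q ^+ n.*2.+1)^-1.
Proof.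
have gt1 r y : 1 < r -> 0 < y -> exists n, M < y * r ^+ n.*2.+1.
  move=> r1 y0; have r0 : 0 < r by lra.
  (* Bernoulli gives [y * r ^+ n >= y * (1 + n (r - 1))], so any [n] above [M / (y * (r - 1))] will
     do. *)
  pose n := Num.Def.archi_bound (M / (y * (r - 1))); exists n.
  have cy : 0 < y * (r - 1) by rewrite mulr_gt0// subr_gt0.
  have [M0|M0] := ltP M 0; first by apply: lt_trans M0 _;
    rewrite mulr_gt0// exprn_gt0.
  have := @archi_boundP _ (M / (y * (r - 1))) (divr_ge0 M0 (ltW cy)).
  rewrite -/n ltr_pdivrMr// => /lt_le_trans; apply.
  have -> : n%:R * (y * (r - 1)) = y * ((r - 1) *+ n) by rewrite -mulr_natl;
    ring.
  rewrite ler_pM2l//; have r1' : 0 <= r - 1 by lra.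
  have := bernoulli_ineq n r1'; rewrite (_ : 1 + (r - 1) = r); last by ring.
  move=> B; apply: (@le_trans _ _ (r ^+ n)); first by lra.
  by rewrite ler_eXn2l// -addnn ltnW// ltnS leq_addr.
move=> q0 q1 x0; have p0 n : 0 < x * q ^+ n by rewrite mulr_gt0// exprn_gt0.
move: q1; rewrite neq_lt => /orP[q1|q1].
  have [n Hn] : exists n, M < x^-1 * q^-1 ^+ n.*2.+1.
    by apply: gt1; rewrite ?invr_gt0// invf_gt1.
  exists n; apply: lt_le_trans Hn _.
  by rewrite invfM exprVn lerDr ltW.
have [n Hn] := gt1 q x q1 x0; exists n.
by apply: lt_le_trans Hn _; rewrite lerDl invr_ge0 ltW.
Qed.

(** If no factor vanished, induction would make every partial product strictly positive, and the
    negative factor at [n0] would then make the next one negative. *)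
Lemma nonneg_product_terminates (R : realDomainType) (lam w : nat -> R) n0 :
  0 < lam 0%N -> (forall n, 0 <= lam n) ->
  (forall n, lam n.+1 = lam n * w n) -> w n0 < 0 -> exists n, w n = 0.
Proof.
move=> lam0 lam_ge0 lamS w0; apply: contrapT => nw.
have lam_gt0 n : 0 < lam n.
  elim: n => // n IH; rewrite lt_neqAle lam_ge0 lamS andbT eq_sym mulf_eq0.
  by rewrite gt_eqF//=; apply/eqP => wn; apply: nw; exists n.
have := lam_ge0 n0.+1; rewrite lamS pmulr_rge0//.
by rewrite leNgt w0.
Qed.

(** The difference of the two sides, multiplied by [y * z], factors as [(y - z) * (y * z - 1)]. *)
Lemma add_inv_inj (F : fieldType) (y z : F) : y != 0 -> z != 0 ->
  y + y^-1 = z + z^-1 -> y = z \/ y * z = 1.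
Proof.
move=> y0 z0 yz.
have : (y - z) * (y * z - 1) = 0.
  have -> : (y - z) * (y * z - 1) = y * z * (y + y^-1 - (z + z^-1)).
    by field; rewrite y0 z0.
  by rewrite yz subrr mulr0.
by move/eqP; rewrite mulf_eq0 !subr_eq0 => /orP[]/eqP; [left|right].
Qed.

(* The two sides are the zeros coming from the powers of E and of F. *)
Lemma not_between_powers (R : archiRealFieldType) (q x : R) (m n : nat) :
  0 < q -> q != 1 -> 0 < x ->
  x * q ^+ n.*2.+1 + (x * q ^+ n.*2.+1)^-1 =
    x^-1 * q ^+ m.*2.+1 + (x^-1 * q ^+ m.*2.+1)^-1 ->
  0 <= (x - 1) * (x - q).
Proof.
move=> q0 q1 x0 /add_inv_inj.
have ne0 : forall k, q ^+ k != 0 by move=> k; rewrite expf_neq0// gt_eqF.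
have x_n0 : x != 0 by rewrite gt_eqF.
case; rewrite ?mulf_neq0 ?invr_neq0// => H.
  (* In this case [x] will turn out to be the integer power [q^(m - n)]. *)
  have {}H : x ^+ 2 * q ^+ n.*2 = q ^+ m.*2.
    apply: (mulfI (x := x^-1 * q));
      first by rewrite mulf_neq0// ?invr_neq0 ?gt_eqF.
    by rewrite mulrACA [X in X * _]mulrC; move: H; rewrite !exprS => H;
      rewrite -[RHS]mulrA -H; field.
  have {}H : x * q ^+ n = q ^+ m.
    apply: (@pexpIrn _ 2) => //; rewrite ?nnegrE ?mulr_ge0 ?exprn_ge0 ?ltW//.
    by rewrite exprMn -!exprM !muln2.
  have qn : 0 < q ^+ n by rewrite exprn_gt0.
  (* The exponent [m - n] is either at most 0 or at least 1; monotonicity of powers then places [x]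
     outside the open interval between 1 and [q]. *)
  move: q1; rewrite neq_lt => /orP[q1|q1]; have [mn|nm] := leqP m n.
  - have : q ^+ n <= x * q ^+ n by rewrite H ler_iXn2l.
    by rewrite -{1}[q ^+ n]mul1r ler_pM2r// => x1; rewrite mulr_ge0//; lra.
  - have : x * q ^+ n <= q * q ^+ n by rewrite H -exprS ler_iXn2l.
    by rewrite ler_pM2r// => x1; rewrite mulr_le0//; lra.
  - have : x * q ^+ n <= q ^+ n by rewrite H ler_eXn2l.
    by rewrite -[leRHS]mul1r ler_pM2r// => x1; rewrite mulr_le0//; lra.
  - have : q * q ^+ n <= x * q ^+ n by rewrite H -exprS ler_eXn2l.
    by rewrite ler_pM2r// => x1; rewrite mulr_ge0//; lra.
(* In the other case [x] cancels and a positive power of [q] would be 1. *)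
exfalso; move: H; rewrite mulrACA mulfV// mul1r -exprD => /eqP.
by rewrite pexprn_eq1 ?ltW// (negbTE q1).
Qed.

Lemma sqr_sub1_neq0 (R : realDomainType) (q : R) :
  0 < q -> q != 1 -> q * q - 1 != 0.
Proof.
by move=> q0 q1; rewrite subr_eq0 -expr2 pexprn_eq1 ?ltW// (negbTE q1).
Qed.

(** * Commutation relations and the Casimir element *)

Section UqWeights.
Variables (R : realType) (q : R).
Hypotheses (q0 : 0 < q) (q1 : q != 1).
Local Notation C x := ((x)%:C)%C.
Local Notation d := (q - q^-1).
Local Notation E := (uqE q).
Local Notation F := (uqF q).
Local Notation K := (uqK q).
Local Notation Ki := (uqKi q).

Let qn0 : q != 0. Proof. by rewrite gt_eqF. Qed.
Let qXn0 n : C (q ^+ n) != 0 :> R[i].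
Proof. by rewrite fmorph_eq0 expf_neq0. Qed.

Let d0 : q * q - 1 != 0. Proof. exact: sqr_sub1_neq0. Qed.

Lemma uqKKi : K * Ki = 1. Proof. by have [[]] := uq_relP q. Qed.
Lemma uqKiK : Ki * K = 1. Proof. by have [[]] := uq_relP q. Qed.

Lemma uqKi_comm (c : R[i]) (x : uq q) :
  c != 0 -> K * x = c *: (x * K) -> Ki * x = c^-1 *: (x * Ki).
Proof.
move=> c0 Kx; have : Ki * (K * x) * Ki = c *: (Ki * x).
  by rewrite Kx -scalerAr -scalerAl -!mulrA uqKKi mulr1.
rewrite mulrA uqKiK mul1r => ->.
by rewrite scalerA mulVf// scale1r.
Qed.

Lemma uqKEn n : K * E ^+ n = C (q ^+ n.*2) *: (E ^+ n * K).
Proof.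
have KE : K * E = C (q ^+ 2) *: (E * K).
  have [_ KEKi _ _] := uq_relP q.
  by rewrite scalerAl -KEKi -!mulrA uqKiK mulr1.
elim: n => [|n IH]; first by rewrite double0 !expr0 mulr1 mul1r scale1r.
rewrite exprS mulrA KE -scalerAl -(mulrA E K) IH -scalerAr scalerA mulrA.
by rewrite -rmorphM -exprD.
Qed.

Lemma uqKFn n : K * F ^+ n = C (q ^- n.*2) *: (F ^+ n * K).
Proof.
have KF : K * F = C (q ^- 2) *: (F * K).
  have [_ _ KFKi _] := uq_relP q.
  by rewrite scalerAl -KFKi -!mulrA uqKiK mulr1.
elim: n => [|n IH]; first by rewrite double0 !expr0 mulr1 mul1r invr1 scale1r.
rewrite exprS mulrA KF -scalerAl -(mulrA F K) IH -scalerAr scalerA mulrA.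
by rewrite -rmorphM -invfM -exprD.
Qed.

Lemma uqKiEn n : Ki * E ^+ n = C (q ^- n.*2) *: (E ^+ n * Ki).
Proof. by rewrite fmorphV; exact: uqKi_comm (qXn0 _) (uqKEn n). Qed.

Lemma uqKiFn n : Ki * F ^+ n = C (q ^+ n.*2) *: (F ^+ n * Ki).
Proof.
rewrite -[q ^+ n.*2]invrK fmorphV; apply: (uqKi_comm _ (uqKFn n)).
by rewrite fmorphV invr_neq0 ?qXn0.
Qed.

Definition casimir : uq q := F * E + (C (q / d ^+ 2) *: K + C (q^-1 / d ^+ 2)
  *: Ki).

(** Exchanging the coefficients of [K] and [Ki] compensates for the commutator of [E] and [F],
    because [(q - q^-1) / d ^+ 2 = d^-1]. *)
Lemma casimirEF :
  casimir = E * F + (C (q^-1 / d ^+ 2) *: K + C (q / d ^+ 2) *: Ki).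
Proof.
have [_ _ _ EF] := uq_relP q; rewrite -[E * F](subrK (F * E)) EF /casimir.
rewrite [RHS]addrAC addrC; congr (_ + _).
rewrite scalerBr [RHS]addrACA -scalerDl -scaleNr -scalerDl.
by rewrite -rmorphN -!rmorphD; congr (C _ *: _ + C _ *: _); field;
  rewrite qn0 d0.
Qed.

(** With the form containing [E * F] on the left and the one containing [F * E] on the right, both
    sides contain [E * F * E]; the remaining terms agree by the commutation of [K] and [Ki] with
    [E]. *)
Lemma casimir_commE : GRing.comm casimir E.
Proof.
have KE := uqKEn 1; have KiE := uqKiEn 1; rewrite !expr1 in KE KiE.
rewrite /GRing.comm {1}casimirEF /casimir !(mulrDl, mulrDr) mulrA.
congr (_ + (_ + _)).
  rewrite -scalerAl KE -scalerAr scalerA -rmorphM; congr (C _ *: _).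
  by field; rewrite qn0 d0.
rewrite -scalerAl KiE -scalerAr scalerA -rmorphM; congr (C _ *: _).
by field; rewrite qn0 d0.
Qed.

Lemma casimir_commF : GRing.comm casimir F.
Proof.
have KF := uqKFn 1; have KiF := uqKiFn 1; rewrite !expr1 in KF KiF.
rewrite /GRing.comm {2}casimirEF /casimir !(mulrDl, mulrDr) mulrA.
congr (_ + (_ + _)).
  rewrite -scalerAl KF -scalerAr scalerA -rmorphM; congr (C _ *: _).
  by field; rewrite qn0 d0.
rewrite -scalerAl KiF -scalerAr scalerA -rmorphM; congr (C _ *: _).
by field; rewrite qn0 d0.
Qed.

(** Here [E^* E = F K E] is a multiple of [F E K], and [F E] is the Casimir element minus a
    combination of [K] and [Ki]. Moving [E ^+ n] to the left leaves the Casimir element fixed and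
    rescales [K] and [Ki] by powers of [q]. *)
Lemma starEE_powE n :
  uq_star E * E * E ^+ n =
  E ^+ n * (C (q ^+ n.*2.+2) *: ((casimir -
    (C (q ^+ n.*2.+1 / d ^+ 2) *: K + C (q ^- n.*2.+1 / d ^+ 2) *: Ki)) * K)).
Proof.
rewrite uq_starE -mulrA -exprS -mulrA uqKEn doubleS -!scalerAr.
congr (_ *: _); rewrite mulrA exprS !mulrA; congr (_ * _).
have -> : F * E = casimir - (C (q / d ^+ 2) *: K + C (q^-1 / d ^+ 2) *: Ki).
  by rewrite /casimir addrK.
move: casimir (commrX n casimir_commE) => cas cas_comm.
rewrite mulrBl mulrBr mulrDl mulrDr -!scalerAl uqKEn uqKiEn -!scalerAr !scalerA.
congr (_ - (_ + _)); first exact: cas_comm.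
  by rewrite -rmorphM; congr (C _ *: _); rewrite (exprS q n.*2); field;
    rewrite ?d0 ?qn0 ?expf_neq0.
rewrite -rmorphM; congr (C _ *: _); rewrite (exprS q n.*2); field.
by rewrite ?d0 ?qn0 ?expf_neq0.
Qed.

Lemma starFF_powF n :
  uq_star F * F * F ^+ n =
  F ^+ n * (C (q ^+ n.*2) *: ((casimir -
    (C (q ^- n.*2.+1 / d ^+ 2) *: K + C (q ^+ n.*2.+1 / d ^+ 2) *: Ki)) * Ki)).
Proof.
have -> : uq_star F * F = (casimir -
    (C (q^-1 / d ^+ 2) *: K + C (q / d ^+ 2) *: Ki)) * Ki.
  (* [F^* F] is [Ki * E * F]; moving [Ki] to the right exposes [E * F], which the Casimir element
     expresses through [K] and [Ki]. *)
  have cK : GRing.comm Ki (E * F).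
    have [KE KF] := (uqKiEn 1, uqKiFn 1); rewrite !expr1 in KE KF.
    rewrite /GRing.comm mulrA KE -scalerAl -(mulrA E Ki) KF -scalerAr scalerA
      mulrA.
    by rewrite -rmorphM mulVf ?expf_neq0// rmorph1 scale1r.
  by rewrite casimirEF addrK uq_starF -mulrA cK.
rewrite -mulrA uqKiFn -!scalerAr; congr (_ *: _); rewrite !mulrA; congr (_ * _).
move: casimir (commrX n casimir_commF) => cas cas_comm.
rewrite mulrBl mulrBr mulrDl mulrDr -!scalerAl uqKFn uqKiFn -!scalerAr !scalerA.
congr (_ - (_ + _)); first exact: cas_comm.
  rewrite -rmorphM; congr (C _ *: _); rewrite (exprS q n.*2); field.
  by rewrite ?d0 ?qn0 ?expf_neq0.
by rewrite -rmorphM; congr (C _ *: _); rewrite (exprS q n.*2); field;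
  rewrite ?d0 ?qn0 ?expf_neq0.
Qed.

End UqWeights.

(** * Elementary properties of characters *)

Section CharacterTheory.
Variables (R : realType) (A : gradedStarAlg R) (chi : baseAlg A -> R[i]).
Hypothesis chiP : is_char chi.

Lemma charZ a x : chi (a *: x) = a * chi x.
Proof.
have [chiL _ _ _] := chiP; have chi0 : chi 0 = 0.
  have := chiL 1 0 0; rewrite scale1r addr0 mul1r => /esym/eqP.
  by rewrite -subr_eq0 addrK => /eqP.
by have := chiL a x 0; rewrite addr0 chi0 addr0.
Qed.

Lemma charD x y : chi (x + y) = chi x + chi y.
Proof. by have [chiL _ _ _] := chiP; have := chiL 1 x y;
  rewrite scale1r mul1r. Qed.

Lemma charN x : chi (- x) = - chi x.
Proof. by rewrite -scaleN1r charZ mulN1r. Qed.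

Lemma charB x y : chi (x - y) = chi x - chi y.
Proof. by rewrite charD charN. Qed.

Lemma charM x y : chi (x * y) = chi x * chi y.
Proof. by have [_ chiM _ _] := chiP. Qed.

Lemma char1 : chi 1 = 1.
Proof.
have [_ _ _ [x x0]] := chiP; apply: (mulIf x0).
by rewrite -charM !mul1r.
Qed.

Lemma char_real x : base_invol x = x -> exists r, chi x = (r%:C)%C.
Proof.
move=> xE; have [_ _ chi_conj _] := chiP; have := chi_conj x.
rewrite xE; case: (chi x) => a b [bE]; exists a; congr (_ +i* _)%C.
lra.
Qed.

End CharacterTheory.

(** * Positive characters of the quantized enveloping algebra *)

Section UqCharacter.
Variables (R : realType) (q : R).
Hypotheses (q0 : 0 < q) (q1 : q != 1).
Local Notation A := (Uq_su2 q).
Local Notation C x := ((x)%:C)%C.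
Local Notation d := (q - q^-1).

Lemma deg0_K : (uqK q : A) \in @deg0 R A. Proof. exact/deg0P/deg_K. Qed.
Lemma deg0_Ki : (uqKi q : A) \in @deg0 R A. Proof. exact/deg0P/deg_Ki. Qed.
Lemma deg0_casimir : (casimir q : A) \in @deg0 R A.
Proof.
apply/deg0P; rewrite -[casimir q]scale1r /casimir scalerDr; apply: deg_lin.
  by rewrite -(addNr 1); apply: deg_mul; [exact: deg_F | exact: deg_E].
rewrite scale1r; apply: deg_lin; first exact: deg_K.
by apply: uq_degZ; exact: deg_Ki.
Qed.

Definition baseK : baseAlg A := Sub (uqK q : A) deg0_K.
Definition baseKi : baseAlg A := Sub (uqKi q : A) deg0_Ki.
Definition base_cas : baseAlg A := Sub (casimir q : A) deg0_casimir.

Lemma grade_En n : grade A n%:Z (uqE q ^+ n : A).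
Proof.
elim: n => [|n IH]; first exact: deg_1.
by rewrite exprS intS; apply: deg_mul => //; exact: deg_E.
Qed.

Lemma grade_Fn n : grade A (- n%:Z) (uqF q ^+ n : A).
Proof.
elim: n => [|n IH]; first exact: deg_1.
by rewrite exprS intS opprD; apply: deg_mul => //; exact: deg_F.
Qed.

(** Regrouping [(E^n)^* (E^* E E^n)] turns the squares into a product inside the degree-zero
    algebra, so that a character yields a scalar recursion. *)
Lemma squareES n : square (grade_En n.+1) = square (grade_En n) *
  (C (q ^+ n.*2.+2) *: ((base_cas -
    (C (q ^+ n.*2.+1 / d ^+ 2) *: baseK +
     C (q ^- n.*2.+1 / d ^+ 2) *: baseKi)) * baseK)).
Proof.
apply: val_inj.
rewrite /= -(mulrA (uq_star (uqE q ^+ n))) -(starEE_powE q0 q1).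
by rewrite exprS uq_starM !mulrA.
Qed.

Lemma squareFS n : square (grade_Fn n.+1) = square (grade_Fn n) *
  (C (q ^+ n.*2) *: ((base_cas -
    (C (q ^- n.*2.+1 / d ^+ 2) *: baseK +
     C (q ^+ n.*2.+1 / d ^+ 2) *: baseKi)) * baseKi)).
Proof.
apply: val_inj.
rewrite /= -(mulrA (uq_star (uqF q ^+ n))) -(starFF_powF q0 q1).
by rewrite exprS uq_starM !mulrA.
Qed.

(** For [chi baseK > 0], positivity on the squares of the powers of [E] and of [F] forces both
    scalar products to terminate. The two zeros determine the same Casimir value, and comparing them
    excludes values strictly between 1 and [q]. *)
Lemma Bhat_pos_gap (chi : baseAlg A -> R[i]) : Bhat_pos A chi ->
  0 <= chi ((baseK - 1) * (baseK - C q *: 1)).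
Proof.
move=> [chiP pos].
have [x xE] : exists r, chi baseK = C r.
  by apply: (char_real chiP); apply: val_inj; exact: uq_starK.
rewrite (charM chiP) !(charB chiP) (charZ chiP) (char1 chiP) xE mulr1.
rewrite -(rmorph1 (real_complex R)) -!rmorphB -rmorphM -(rmorph0 (real_complex
  R)).
rewrite lecR.
have KKi : C x * chi baseKi = 1.
  rewrite -xE -(charM chiP) -(char1 chiP); congr chi; apply: val_inj.
  exact: uqKKi.
have xn0 : x != 0.
  by apply: contra_eq_neq KKi => ->; rewrite mul0r eq_sym oner_eq0.
have xiE : chi baseKi = C x^-1.
  by apply: (mulfI (x := C x)); rewrite ?fmorph_eq0// KKi -rmorphM mulfV.
(* For negative [x] both factors [x - 1] and [x - q] are negative. *)
have [x0|x0] := ltP x 0;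
  first by rewrite mulr_le0 // subr_le0 ltW// (lt_trans x0).
have {x0}xgt0 : 0 < x by rewrite lt_neqAle eq_sym xn0.
have qq1 := sqr_sub1_neq0 q0 q1.
have d2 : 0 < d ^+ 2.
  rewrite exprn_even_gt0//=; have -> : d = (q * q - 1) / q by field;
    rewrite gt_eqF.
  by rewrite mulf_neq0// invr_neq0// gt_eqF.
set c := complex.Re (chi base_cas).
(* One argument serves both generators, with [y = x] for [E] and [y = x^-1] for [F]. Each [lam n] is
   real, so the recursion holds for real parts with [c] as Casimir value, and [w n > 0] leaves the
   sign to the bracket. *)
have term (y : R) (lam : nat -> R[i]) (w : nat -> R) : 0 < y ->
    lam 0%N = 1 -> (forall n, 0 <= lam n) -> (forall n, 0 < w n) ->
    (forall n, lam n.+1 = lam n * (C (w n) * (chi base_cas -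
       C ((y * q ^+ n.*2.+1 + (y * q ^+ n.*2.+1)^-1) / d ^+ 2)))) ->
    exists n, c * d ^+ 2 = y * q ^+ n.*2.+1 + (y * q ^+ n.*2.+1)^-1.
  move=> y0 lam0 lam_ge0 w0 lamS.
  pose v n := w n * (c - (y * q ^+ n.*2.+1 + (y * q ^+ n.*2.+1)^-1) / d ^+ 2).
  have [n0 Hn0] := odd_powers_unbounded (c * d ^+ 2) q0 q1 y0.
  have [||||n] := @nonneg_product_terminates _ (fun n => complex.Re (lam n)) v
    n0.
  - by rewrite lam0.
  - by move=> n; have := lam_ge0 n; rewrite lecE => /andP[].
  - move=> n; rewrite lamS /v /c; have := lam_ge0 n.
    case: (lam n) => l l'; rewrite lecE /= => /andP[/eqP -> _].
    by case: (chi base_cas) => a b /=; ring.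
  - by rewrite /v nmulr_llt0 ?w0// subr_lt0 ltr_pdivlMr.
  rewrite /v => /eqP; rewrite mulf_eq0 gt_eqF//= subr_eq0 => /eqP ->.
  by exists n; rewrite divfK// gt_eqF.
have qp n : 0 < q ^+ n by rewrite exprn_gt0.
have sq0 : chi (square (grade_En 0)) = 1 /\ chi (square (grade_Fn 0)) = 1.
  by split; rewrite -(char1 chiP); congr chi; apply: val_inj;
     rewrite /= !expr0 mulr1; have := uq_starC q 1; rewrite conjC1 !scale1r.
have [n Hn] : exists n, c * d ^+ 2 = x * q ^+ n.*2.+1 + (x * q ^+ n.*2.+1)^-1.
  apply: (term x (fun n => chi (square (grade_En n)))
    (fun n => q ^+ n.*2.+2 * x)) => //; first by case: sq0.
  - by move=> n; rewrite mulr_gt0.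
  move=> n; rewrite squareES !(charM chiP, charD chiP, charN chiP, charZ chiP).
  rewrite xE xiE -!rmorphM -!rmorphD [C (_ * x)]rmorphM; congr (_ * _).
  rewrite -[RHS]mulrA; congr (_ * _); rewrite mulrC; congr (_ * (_ - C _)).
  by field; rewrite gt_eqF// qq1 expf_neq0 ?gt_eqF.
have [m Hm] : exists n, c * d ^+ 2 =
    x^-1 * q ^+ n.*2.+1 + (x^-1 * q ^+ n.*2.+1)^-1.
  apply: (term x^-1 (fun n => chi (square (grade_Fn n)))
    (fun n => q ^+ n.*2 * x^-1)) => //; rewrite ?invr_gt0//; first by case: sq0.
  - by move=> k; rewrite mulr_gt0// invr_gt0.
  move=> k; rewrite squareFS !(charM chiP, charD chiP, charN chiP, charZ chiP).
  rewrite xE xiE -!rmorphM -!rmorphD [C (_ * x^-1)]rmorphM; congr (_ * _).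
  rewrite -[RHS]mulrA; congr (_ * _); rewrite mulrC; congr (_ * (_ - C _)).
  by field; rewrite gt_eqF// qq1 expf_neq0 ?gt_eqF.
apply: (not_between_powers q0 q1 xgt0 (n := n) (m := m)).
by rewrite -Hn -Hm.
Qed.

End UqCharacter.

(** * Spectral measures and positive functions *)

Section NullSetIntegral.
Import HBNNSimple.
Local Open Scope ereal_scope.
Local Open Scope classical_set_scope.
Context d (X : measurableType d) (R : realType).
Variables (mu : set X -> \bar R) (S : set X).
Hypothesis mu0 : forall D, measurable D -> D `&` S = set0 -> mu D = 0.

(** Every level set of [h] at a nonzero value misses [S], hence has measure 0. *)
Lemma sintegral_eq0_on (h : {nnsfun X >-> R}) :
  (forall x, S x -> h x = 0%R) -> sintegral mu h = 0.
Proof.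
move=> hS; rewrite sintegralET fsbig1// => r _.
have [->|r0] := eqVneq r 0%R; first by rewrite mul0e.
rewrite mu0 ?mule0//.
apply/seteqP; split=> // x [/= hx Sx].
by move: r0; rewrite -hx hS// eqxx.
Qed.

(* [integral] is applied to set functions that are not known to be measures, so
   its positivity has to be reproved from the definition. *)
Lemma integral_ge0_on (f : X -> \bar R) :
  (forall x, S x -> 0 <= f x) -> 0 <= integral mu setT f.
Proof.
move=> fS; rewrite /integral patch_setT.
(* [P] and [N] are the suprema for the positive and negative parts. The zero function competes in
   both, and a simple function below the negative part vanishes on [S]. *)
set P := ereal_sup _; set N := ereal_sup _.
have P0 : 0 <= P.
  apply: ereal_sup_ubound; exists nnsfun0; last exact: sintegral_eq0_on.
  by move=> x; exact: funepos_ge0.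
suff -> : N = 0 by rewrite sube0.
apply/eqP; rewrite eq_le; apply/andP; split.
  apply: ge_ereal_sup => _ [h /= hf <-]; rewrite sintegral_eq0_on// => x Sx.
  have fx0 : - f x <= 0 by rewrite oppe_le0 fS.
  have := hf x; rewrite funenegE (max_idPr fx0) lee_fin => hx.
  by apply/eqP; rewrite eq_le hx/=.
apply: ereal_sup_ubound; exists nnsfun0; last exact: sintegral_eq0_on.
by move=> x; exact: funeneg_ge0.
Qed.

Lemma integral_eq0_on (f : X -> \bar R) :
  (forall x, S x -> f x = 0) -> integral mu setT f = 0.
Proof.
move=> fS; rewrite /integral patch_setT.
suff Z (g : X -> \bar R) : (forall x, S x -> g x = 0) -> (forall x, 0 <= g x) ->
    ereal_sup [set sintegral mu h |
      h in [set h : {nnsfun X >-> R} | forall x, (h x)%:E <= g x]] = 0.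
  rewrite !Z ?sube0//.
  - by move=> x Sx; rewrite funenegE fS// oppe0 maxxx.
  - by move=> x Sx; rewrite funeposE fS// maxxx.
move=> gS g0; apply/eqP; rewrite eq_le; apply/andP; split.
  apply: ge_ereal_sup => _ [h /= hg <-]; rewrite sintegral_eq0_on// => x Sx.
  have := hg x; rewrite gS// lee_fin => hx.
  by apply/eqP; rewrite eq_le hx/=.
by apply: ereal_sup_ubound; exists nnsfun0 => //; exact: sintegral_eq0_on.
Qed.

End NullSetIntegral.

(** * Positivity of spectral integrals *)

Section SpectralMeasureTheory.
Local Open Scope classical_set_scope.
Context (R : realType) (H : hilbertSpace R) d (X : measurableType d).
Variable (E : set X -> H -> H).
Hypothesis EP : spectral_measure E.

(** Additivity over a sequence of empty sets makes the partial sums converge, so their increments,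
    constantly [E set0 u], tend to 0. *)
Lemma spectral_set0 u : E set0 u = 0.
Proof.
have [_ _ _ ET Esig] := EP.
have triv : trivIset setT (fun _ : nat => set0 : set X) by move=> i j _ _ [x
  []].
have cv := Esig (fun=> set0) (fun=> measurable0) triv u.
pose s n := \sum_(k < n) E set0 u.
have {}cv : s @ \oo --> E set0 u by rewrite bigcup0 in cv.
have cv0 : (fun n => s n.+1 - s n) @ \oo --> E set0 u - E set0 u.
  by apply: cvgB => //; rewrite cvg_shiftS.
rewrite (_ : (fun n => _) = cst (E set0 u)) ?subrr in cv0; last first.
  by apply/funext => n; rewrite /s big_ord_recr /= addrC addrK.
by apply: (cvg_unique _ (cvg_cst _) cv0); exact: norm_hausdorff.
Qed.

Lemma spectralU D1 D2 u : measurable D1 -> measurable D2 -> D1 `&` D2 = set0 ->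
  E (D1 `|` D2) u = E D1 u + E D2 u.
Proof.
move=> m1 m2 D12; have [_ _ _ _ Esig] := EP.
have mb k : measurable (bigcup2 D1 D2 k) by case: k => [|[|k]] /=.
have := Esig _ mb; rewrite -trivIset_bigcup2 bigcup2E => /(_ D12 u) cv.
apply: (cvg_unique _ cv); first exact: norm_hausdorff.
rewrite /= -(cvg_shiftn 2 (fun n => \sum_(k < n) E (bigcup2 D1 D2 k) u));
  apply: cvg_near_cst; apply: nearW => n.
rewrite /= addn2 big_ord_recl big_ord_recl big1 ?addr0// => i _.
exact: spectral_set0.
Qed.

Variable S : set X.
Hypotheses (mS : measurable S) (ES : forall u, E S u = u).

(* The operator P of D satisfies (P + 1)^2 = P + 1. *)
Lemma spectral_disjoint0 D u : measurable D -> D `&` S = set0 -> E D u = 0.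
Proof.
move=> mD DS; have [Elin Eidem _ _ _] := EP.
have EDS v : E (D `|` S) v = E D v + v by rewrite spectralU// ES.
have EDD v w : E D (v + w) = E D v + E D w.
  by have := Elin _ mD 1 v w; rewrite !scale1r.
(* Expanding the idempotence on the union and using that of [E D] leaves twice [E D u] equal to
   0. *)
have := Eidem _ (measurableU _ _ mD mS) u; rewrite /= !EDS EDD.
rewrite [E D (E D u)](Eidem _ mD u).
rewrite -!addrA => /addrI; rewrite addrA => /eqP; rewrite -subr_eq0 addrK.
rewrite -mulr2n -scaler_nat scaler_eq0 pnatr_eq0/=.
by move/eqP.
Qed.

Variable f : X -> R[i].
Hypothesis f_ge0 : forall x, S x -> 0 <= f x.

Lemma cintegral_spectral_ge0 u : 0 <= cintegral (spectral_pre E u) f.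
Proof.
have mu0 D : measurable D -> D `&` S = set0 -> spectral_pre E u D = 0%E.
  move=> mD DS; rewrite /spectral_pre spectral_disjoint0//.
  by rewrite linear0l.
have fS x : S x -> (0 <= complex.Re (f x)) /\ complex.Im (f x) = 0.
  by move/f_ge0; rewrite lecE => /andP[/eqP ->].
rewrite /cintegral (@integral_eq0_on _ _ _ _ S mu0 (fun x => (complex.Im (f
  x))%:E)).
  (* An infinite integral is sent to 0 by [fine], which keeps the sign. *)
  rewrite lecE /= eqxx/=; apply: fine_ge0.
  by apply: (@integral_ge0_on _ _ _ _ S mu0) => x /fS[fx _]; rewrite lee_fin.
by move=> x /fS[_ ->].
Qed.

Lemma cintegral_spectral0 : cintegral (spectral_pre E 0) f = 0.
Proof.
have mu0 D : measurable D -> D `&` set0 = set0 -> spectral_pre E (0 : H) D =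
  0%E.
  by move=> mD _; rewrite /spectral_pre linear0r.
rewrite /cintegral !(@integral_eq0_on _ _ _ _ set0 mu0)//.
Qed.

(** In the polarization sum at [v = u], the term [k = 2] belongs to the zero vector, and the terms
    [k = 1] and [k = 3] are real integrals times plus or minus ['i]. Only the nonnegative term
    [k = 0] contributes to the real part. *)
Lemma Re_sesq_integral_ge0 u : 0 <= complex.Re (sesq_integral E f u u).
Proof.
have sum4 (g : nat -> R[i]) : \sum_(k < 4) g k = g 0%N + g 1%N + g 2%N + g 3%N.
  by rewrite !big_ord_recr big_ord0 /= add0r.
rewrite /sesq_integral
  (sum4 (fun k => 'i ^+ k * cintegral (spectral_pre E (u + 'i ^+ k *: u)) f)).
rewrite expr0 expr1 (exprD _ 1 2) expr1 sqrCi scaleN1r subrr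
  cintegral_spectral0.
rewrite mulr0 addr0 scale1r mul1r mulrN1.
(* This is deduced from ['i ^+ 2 = -1] alone: the imaginary part of the square forces one component
   to vanish, and a real number cannot have square -1. *)
have i0 : complex.Re ('i : R[i]) = 0.
  have := @sqrCi R[i]; case: ('i) => a b; rewrite expr2 => -[/= re im].
  have {im} /eqP : a * b = 0 by move: im; rewrite oppr0; lra.
  by rewrite mulf_eq0 => /orP[/eqP//|/eqP b0]; move: re; rewrite b0; nra.
have realE v : exists2 r, 0 <= r & cintegral (spectral_pre E v) f = (r%:C)%C.
  have := cintegral_spectral_ge0 v; case: cintegral => a b.
  by rewrite lecE /= => /andP[/eqP -> a0]; exists a.
have [r0 r0_ge0 ->] := realE (u + u).
have [r1 _ ->] := realE (u + 'i *: u).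
have [r3 _ ->] := realE (u + - 'i *: u).
have -> : (4^-1 : R[i]) = ((4^-1)%:C)%C by rewrite fmorphV (rmorph_nat
  (real_complex R)).
move: i0; case: ('i) => a b /= ->; rewrite !(mulr0, mul0r, subr0, addr0, oppr0).
lra.
Qed.

End SpectralMeasureTheory.

(** * Negative eigenvalues in well-behaved representations *)

Section Obstruction.
Local Open Scope classical_set_scope.
Context (R : realType) (A : gradedStarAlg R) (H : hilbertSpace R).
Variables (rho : starRep A H) (b : baseAlg A) (c : R) (u : H).
Hypotheses (b_ge0 : forall chi, Bhat_pos A chi -> 0 <= chi b) (c0 : c < 0).
Hypotheses (rho_wb : well_behaved rho) (Du : rep_dom rho u).
Hypothesis rho_b : rho (val b) u = (c%:C)%C *: u.

Lemma measurable_Bhat_pos : measurable (Bhat_pos A : set (char_space A)).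
Proof. by apply: sub_sigma_algebra; exact: open_subspaceT. Qed.

(** The spectral formula makes the real part of the form of [b] at [u] nonnegative, while the
    eigenvalue equation makes it [c] times the squared norm, with [c < 0]. *)
Lemma well_behaved_eigen_eq0 : u = 0.
Proof.
have [_ _ [E [[EP ES Ebar] _]]] := rho_wb.
have : op_bar rho (val b) (u, (c%:C)%C *: u).
  by apply: subset_closure; split => //=; rewrite rho_b.
(* As [u] lies in the domain of the spectral integral, it may serve as the test vector as well. *)
rewrite Ebar => -[/= Eu /(_ _ Eu)].
move=> /(congr1 (@complex.Re R)).
have := Re_sesq_integral_ge0 EP measurable_Bhat_pos ES b_ge0 u.
move=> + Ere; rewrite -Ere linearZl_LR /= -hdotE.
have -> : `|u| = ((complex.Re `|u|)%:C)%C.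
  by have := normr_ge0 u; rewrite lecE /=;
    case: (`|u|) => x y /= /andP[/eqP ->].
rewrite -rmorphXn -rmorphM /= => cu.
have {cu} : complex.Re `|u| ^+ 2 <= 0 by rewrite -(nmulr_rge0 _ c0).
rewrite exprn_even_le0//= => /eqP nu.
apply/eqP; rewrite -normr_eq0; apply/eqP.
have := normr_ge0 u; rewrite lecE /=; move: nu;
  case: (`|u|) => x y /= -> /andP[/eqP -> _].
by [].
Qed.

End Obstruction.

(** * Square-summable families *)

Section DotNorm.
Variables (C : numClosedFieldType) (U : lmodType C) (form : {dot U for
  @Num.conj C}).
Local Notation "''[' u , v ]" := (form u v) : ring_scope.

Lemma dot_CauchySchwarz u v : `|'[u, v]| ^+ 2 <= '[u, u] * '[v, v].
Proof.
have [->|v0] := eqVneq v 0; first by rewrite !linear0r normr0 expr0n.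
have vv : 0 < '[v, v] by rewrite dnorm_gt0.
(* [a *: v] is the orthogonal projection of [u] onto the line through [v]. *)
pose a := '[u, v] / '[v, v]; pose w := u - a *: v.
have ow : '[w, v] = 0.
  by rewrite linearBl/= linearZl_LR /= divfK ?subrr// gt_eqF.
have -> : u = w + a *: v by rewrite subrK.
rewrite linearDl /= ow add0r linearZl_LR /= normrM exprMn (ger0_norm (ltW vv)).
have owa : '[w, a *: v] = 0 by rewrite linearZr_LR /= ow mulr0.
by rewrite dnormD owa conjC0 !addr0 dnormZ mulrDl -[X in _ + X]mulrA -expr2
  lerDr mulr_ge0 ?(ltW vv).
Qed.

Lemma dot_triangle u v :
  sqrtC '[u + v, u + v] <= sqrtC '[u, u] + sqrtC '[v, v].
Proof.
have p0 w : 0 <= sqrtC '[w, w] by rewrite sqrtC_ge0 dnorm_ge0.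
rewrite -(@ler_pXn2r _ 2) ?nnegrE ?addr_ge0// sqrrD !sqrtCK dnormD.
rewrite [leRHS]addrAC lerD2l; apply: le_trans (real_ler_norm _) _.
  by rewrite CrealE rmorphD /= conjCK addrC.
apply: le_trans (ler_normD _ _) _; rewrite norm_conjC -mulr2n lerMn2r /=.
rewrite -(@ler_pXn2r _ 2) ?nnegrE ?mulr_ge0// exprMn !sqrtCK.
exact: dot_CauchySchwarz.
Qed.

End DotNorm.

(** * The Hilbert space of square-summable families *)

Section SquareSummable.
Local Open Scope classical_set_scope.
Variables (R : realType) (T : countType).
Local Notation Re := (@complex.Re R).
Local Notation Im := (@complex.Im R).

(** The elements with code below [N] exhaust [T], so that sums over [T] become limits of real
    sequences. *)
Definition prefix_of (N : nat) : seq T := pmap (@pickle_inv T) (iota 0 N).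

(** This is the real part of the truncated inner product. The imaginary part is recovered by
    replacing [g] with ['i *: g]. *)
Definition re_dot N (f g : T -> R[i]) : R :=
  \sum_(t <- prefix_of N) (Re (f t) * Re (g t) + Im (f t) * Im (g t)).

Definition l2_pred : {pred T -> R[i]} :=
  fun f => `[< exists M, forall N, re_dot N f f <= M >].

Lemma mem_prefix_of N t : (pickle t < N)%N -> t \in prefix_of N.
Proof.
move=> tN; rewrite mem_pmap; apply/mapP; exists (pickle t).
  by rewrite mem_iota.
by rewrite pickleK_inv.
Qed.

Lemma uniq_prefix_of N : uniq (prefix_of N).
Proof.
apply: (pmap_uniq (g := pickle)); last exact: iota_uniq.
exact: pickle_invK.
Qed.

Lemma prefix_ofS N : exists s, prefix_of N.+1 = prefix_of N ++ s.
Proof.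
exists (pmap (@pickle_inv T) [:: N]).
by rewrite /prefix_of -addn1 iotaD pmap_cat.
Qed.

Lemma re_dot_homo f : nondecreasing_seq (fun N => re_dot N f f).
Proof.
apply/nondecreasing_seqP => N; rewrite /re_dot.
have [s ->] := prefix_ofS N; rewrite big_cat /= lerDl.
by apply: sumr_ge0 => t _; rewrite addr_ge0 -?expr2 ?sqr_ge0.
Qed.

Lemma re_dotC N f g : re_dot N f g = re_dot N g f.
Proof. by apply: eq_bigr => t _; ring. Qed.

(** This is [Re (a z) = Re a Re z - Im a Im z], with the imaginary part read off from
    ['i%C *: g]. *)
Lemma re_dotP N (a : R[i]) f f' g : re_dot N (a *: f + f') g =
  Re a * re_dot N f g - Im a * re_dot N f ('i%C *: g) + re_dot N f' g.
Proof.
rewrite /re_dot !big_distrr /= -sumrB -big_split /=; apply: eq_bigr => t _.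
rewrite !fctE /GRing.scale /=.
by case: a (f t) (f' t) (g t) => [? ?] [? ?] [? ?] [? ?] /=; ring.
Qed.

Lemma l2_pred_submod : submod_closed l2_pred.
Proof.
split; first by apply/asboolP; exists 0 => N; rewrite /re_dot big1// => t _ /=;
  ring.
move=> a f g /asboolP[M fM] /asboolP[M' gM]; apply/asboolP.
(* The bound comes from [|a f + g|^2 <= 2 |a|^2 |f|^2 + 2 |g|^2], where the gap is [|a f - g|^2]. *)
exists (2 * (Re a ^+ 2 + Im a ^+ 2) * M + 2 * M') => N.
have h : re_dot N (a *: f + g) (a *: f + g) <=
    2 * (Re a ^+ 2 + Im a ^+ 2) * re_dot N f f + 2 * re_dot N g g.
  rewrite /re_dot !big_distrr /= -big_split /=; apply: ler_sum => t _.
  rewrite !fctE /GRing.scale /=.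
  case: a (f t) (g t) => [a b] [x y] [z w] /=.
  rewrite -subr_ge0.
  have -> : 2 * (a ^+ 2 + b ^+ 2) * (x * x + y * y) + 2 * (z * z + w * w) -
     ((a * x - b * y + z) * (a * x - b * y + z) +
      (a * y + b * x + w) * (a * y + b * x + w)) =
     (a * x - b * y - z) ^+ 2 + (a * y + b * x - w) ^+ 2 by ring.
  by rewrite addr_ge0// sqr_ge0.
apply: le_trans h _; rewrite lerD// ler_wpM2l// mulr_ge0// addr_ge0// sqr_ge0//.
Qed.

HB.instance Definition _ :=
  GRing.isSubmodClosed.Build R[i] (T -> R[i]) l2_pred l2_pred_submod.

Definition l2 := {f : T -> R[i] | f \in l2_pred}.
HB.instance Definition _ := SubChoice.on l2.
HB.instance Definition _ := [SubChoice_isSubLmodule of l2 by <:].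

Definition l2_re_dot (f g : l2) : R := limn (fun N => re_dot N (val f) (val g)).

(** Polarization reduces this to the squared norms of [f + g] and [f - g], whose truncations are
    nondecreasing and bounded. *)
Lemma cvg_re_dot f g : re_dot N (val f) (val g) @[N --> \oo] --> l2_re_dot f g.
Proof.
have cvgQ (h : l2) : cvgn (fun N => re_dot N (val h) (val h)).
  apply: nondecreasing_is_cvgn; first exact: re_dot_homo.
  have /asboolP[M hM] := valP h; exists M => _ [N _ <-]; exact: hM.
rewrite /l2_re_dot (_ : (fun N => _) = (fun N => 4^-1 *
  (re_dot N (val (f + g)) (val (f + g)) - re_dot N (val (f - g)) (val (f -
    g))))).
  by apply: is_cvgMr; apply: is_cvgB; exact: cvgQ.
apply/funext => N; rewrite /re_dot -sumrB big_distrr /=.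
apply: eq_bigr => t _; rewrite !fctE.
by case: (\val f t) (\val g t) => [x y] [z w] /=; field.
Qed.

Lemma l2_re_dotC f g : l2_re_dot f g = l2_re_dot g f.
Proof. by congr (limn _); apply/funext => N; exact: re_dotC. Qed.

Lemma l2_re_dotP (a : R[i]) f f' g : l2_re_dot (a *: f + f') g =
  Re a * l2_re_dot f g - Im a * l2_re_dot f ('i%C *: g) + l2_re_dot f' g.
Proof.
apply: cvg_lim; first exact: Rhausdorff.
rewrite (_ : (fun N => _) = fun N => Re a * re_dot N (val f) (val g) -
  Im a * re_dot N (val f) (val ('i%C *: g)) + re_dot N (val f') (val g)).
  by apply: cvgD; [apply: cvgB; apply: cvgMr|]; exact: cvg_re_dot.
by apply/funext => N; exact: re_dotP.
Qed.

Lemma l2_re_dot0 f : l2_re_dot 0 f = 0.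
Proof.
have := l2_re_dotP 1 0 0 f;
  rewrite scaler0 addr0 /= mul1r mul0r subr0 => /esym/eqP.
by rewrite -subr_eq0 addrK => /eqP.
Qed.

Lemma l2_re_dot_i f g : l2_re_dot f ('i%C *: g) = - l2_re_dot g ('i%C *: f).
Proof.
rewrite l2_re_dotC -['i%C *: g]addr0 l2_re_dotP l2_re_dot0 /=.
by rewrite mul0r mul1r add0r addr0.
Qed.

Definition l2_dot (f g : l2) : R[i] :=
  (l2_re_dot f g +i* l2_re_dot f ('i *: g))%C.

Lemma l2_dotC f g : l2_dot f g = (l2_dot g f)^*.
Proof. by rewrite /l2_dot l2_re_dot_i l2_re_dotC. Qed.

Lemma l2_dotP (a : R[i]) f f' g :
  l2_dot (a *: f + f') g = a * l2_dot f g + l2_dot f' g.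
Proof.
rewrite /l2_dot !l2_re_dotP scalerA.
have -> : 'i%C * 'i%C = -1 :> R[i] by rewrite -expr2 sqr_i.
have -> : l2_re_dot f (-1 *: g) = - l2_re_dot f g.
  by rewrite [LHS]l2_re_dotC -[-1 *: g]addr0 l2_re_dotP l2_re_dot0 /= oppr0
    mul0r subr0 addr0 mulN1r l2_re_dotC.
by case: a => a b; apply/eqP; rewrite eq_complex /=; apply/andP; split;
  apply/eqP; ring.
Qed.

Lemma re_dot_le N f : re_dot N (val f) (val f) <= l2_re_dot f f.
Proof.
apply: (nondecreasing_cvgn_le (re_dot_homo (val f))).
by apply/cvg_ex; eexists; exact: cvg_re_dot.
Qed.

Lemma l2_re_dot_self f : l2_dot f f = ((l2_re_dot f f)%:C)%C.
Proof.
rewrite /l2_dot; congr (_ +i* _)%C; have := l2_re_dot_i f f; lra.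
Qed.

Lemma l2_dot_gt0 f : f != 0 -> 0 < l2_dot f f.
Proof.
move=> f0; rewrite l2_re_dot_self ltcR.
have [t ft] : exists t, val f t != 0.
  apply: contrapT => /forallNP f0'; move/negP: f0; apply;
    apply/eqP/val_inj/funext => t.
  by apply/eqP/negPn/negP => /f0'.
apply: lt_le_trans (re_dot_le (pickle t).+1 f).
rewrite /re_dot (bigD1_seq t)/= ?mem_prefix_of ?uniq_prefix_of//.
rewrite ltr_pwDl//; last by apply: sumr_ge0 => s _;
  rewrite addr_ge0 -?expr2 ?sqr_ge0.
rewrite -!expr2 -ltcR add_Re2_Im2 exprn_gt0// normr_gt0//.
Qed.

Lemma l2_dotPr f : GRing.linear_for (@Num.conj R[i] \; *%R) (l2_dot f).
Proof.
by move=> a g g' /=; rewrite ![l2_dot f _]l2_dotC l2_dotP rmorphD rmorphM.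
Qed.

HB.instance Definition _ := bilinear_isBilinear.Build R[i] l2 l2 R[i]
  ( *%R ) (@Num.conj R[i] \;
    *%R) l2_dot ((fun g a f f' => l2_dotP a f f' g), l2_dotPr).

Lemma l2_dot_hermitian f g : l2_dot f g = (-1) ^+ false * (l2_dot g f)^*.
Proof. by rewrite expr0 mul1r -l2_dotC. Qed.

HB.instance Definition _ := isHermitianSesquilinear.Build R[i] l2 false
  (@Num.conj R[i]) l2_dot l2_dot_hermitian.
HB.instance Definition _ := isDotProduct.Build R[i] l2 l2_dot l2_dot_gt0.

Definition l2_norm (f : l2) : R[i] := sqrtC (l2_dot f f).

Lemma l2_normD f g : l2_norm (f + g) <= l2_norm f + l2_norm g.
Proof. exact: (dot_triangle l2_dot). Qed.

Lemma l2_normZ (a : R[i]) f : l2_norm (a *: f) = `|a| * l2_norm f.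
Proof.
by rewrite /l2_norm (dnormZ l2_dot) sqrtCM ?nnegrE ?exprn_ge0// sqrCK.
Qed.

Lemma l2_norm0_eq0 f : l2_norm f = 0 -> f = 0.
Proof. by move/eqP; rewrite sqrtC_eq0 (dnorm_eq0 l2_dot) => /eqP. Qed.

HB.instance Definition _ :=
  Lmodule_isNormed.Build R[i] l2 l2_normD l2_normZ l2_norm0_eq0.

Lemma l2_normE (f : l2) : `|f| ^+ 2 = l2_dot f f.
Proof. exact: sqrtCK. Qed.

Lemma l2_norm_le (f : l2) (e : R) : 0 <= e ->
  (`|f| <= (e%:C)%C) = (l2_re_dot f f <= e ^+ 2).
Proof.
move=> e0; rewrite -(@ler_pXn2r _ 2) ?nnegrE ?ler0c//.
by rewrite l2_normE l2_re_dot_self -rmorphXn lecR.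
Qed.

Lemma l2_norm_le_re_dot (f : l2) (e : R) : 0 <= e ->
  (forall N, re_dot N (val f) (val f) <= e ^+ 2) -> `|f| <= (e%:C)%C.
Proof.
move=> e0 fe; rewrite l2_norm_le//; apply: limr_le; last exact: nearW.
by apply/cvg_ex; eexists; exact: cvg_re_dot.
Qed.

Lemma re_dot_le_norm N (f : l2) (e : R) : 0 <= e -> `|f| <= (e%:C)%C ->
  re_dot N (val f) (val f) <= e ^+ 2.
Proof. by move=> e0; rewrite l2_norm_le//; apply: le_trans;
  exact: re_dot_le. Qed.

Lemma sqr_coord_le (f : l2) t :
  Re (val f t) ^+ 2 + Im (val f t) ^+ 2 <= re_dot (pickle t).+1 (val f) (val f).
Proof.
rewrite /re_dot (bigD1_seq t)/= ?mem_prefix_of ?uniq_prefix_of// -!expr2 lerDl.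
by apply: sumr_ge0 => s _; rewrite addr_ge0 -?expr2 ?sqr_ge0.
Qed.

Lemma pos_complexP (e : R[i]) : 0 < e -> exists2 r : R, 0 < r & e = (r%:C)%C.
Proof. by case: e => a b; rewrite ltcE /= => /andP[/eqP -> a0]; exists a. Qed.

(** Coordinates are Cauchy and define a pointwise limit. The Cauchy bounds pass to the limit on each
    truncation, uniformly in [N], which gives both membership in [l2] and convergence in norm. *)
Lemma l2_complete (F : set_system l2) : ProperFilter F -> cauchy F -> cvg F.
Proof.
move=> FF /cauchyP Fc.
have {}Fc (e : R) : 0 < e -> exists x : l2, F [set u | `|x - u| <= (e%:C)%C].
  move=> e0; have [|x Fx] := Fc ((e%:C)%C); first by rewrite ltcR.
  exists x; apply: filterS Fx => u; rewrite -ball_normE /=; exact: ltW.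
have cvg_part (p : R[i] -> R) : {morph p : x y / x - y} ->
    (forall z, p z ^+ 2 <= Re z ^+ 2 + Im z ^+ 2) ->
    forall t, cvg (p (val u t) @[u --> F]).
  move=> pB ple t; apply: cauchy_cvg; apply: cauchy_exP => e e0.
  have [|x Fx] := Fc (e / 2); first by lra.
  exists (p (val x t)).
  suff : F [set u | ball (p (val x t)) e (p (val u t))] by [].
  apply: filterS Fx => u /=; rewrite -ball_normE /= => xu.
  have -> : p (\val x t) - p (\val u t) = p (\val (x - u) t) by rewrite -pB.
  have e20 : 0 <= e / 2 by lra.
  suff : `|p (\val (x - u) t)| <= e / 2 by lra.
  rewrite -(@ler_pXn2r _ 2) ?nnegrE// real_normK ?num_real//.
  apply: le_trans (ple _) _; apply: le_trans (sqr_coord_le _ _) _.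
  exact: re_dot_le_norm.
have cvgRe := cvg_part Re (raddfB _).
have cvgIm := cvg_part Im (raddfB _).
have {}cvgRe t : cvg (Re (val u t) @[u --> F]).
  by apply: cvgRe => z; rewrite lerDl sqr_ge0.
have {}cvgIm t : cvg (Im (val u t) @[u --> F]).
  by apply: cvgIm => z; rewrite lerDr sqr_ge0.
pose f t : R[i] :=
  (lim (Re (val u t) @[u --> F]) +i* lim (Im (val u t) @[u --> F]))%C.
(* A truncation is a finite sum, hence continuous under convergence of coordinates. *)
have close (e : R) (x : l2) N : 0 <= e -> F [set u | `|x - u| <= (e%:C)%C] ->
    re_dot N (val x - f) (val x - f) <= e ^+ 2.
  move=> e0 Fx; pose Q (u : l2) := re_dot N (val (x - u)) (val (x - u)).
  have QF : Q u @[u --> F] --> re_dot N (val x - f) (val x - f).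
    rewrite /Q /re_dot; apply: cvg_big; first exact: add_continuous.
    move=> t _; rewrite !fctE.
    have cvgB' (p : R[i] -> R) : {morph p : x y / x - y} ->
        p (f t) = lim (p (val u t) @[u --> F]) -> cvg (p (val u t) @[u --> F])
          ->
        p (val (x - u) t) @[u --> F] --> p (val x t - f t).
      move=> pB pf cp; under eq_cvg do rewrite raddfB !fctE pB.
      by rewrite pB pf; apply: cvgB => //; exact: cvg_cst.
    by apply: cvgD; apply: cvgM; apply: cvgB' => //; exact: raddfB.
  rewrite -(cvg_lim _ QF)//; apply: limr_le; first by apply/cvg_ex; eexists;
    exact: QF.
  by apply: filterS Fx => u /= xu; exact: re_dot_le_norm.
have [x1 Fx1] := Fc 1 ltr01.
have fl2 : f \in l2_pred.
  rewrite -[f](subKr (val x1)) rpredB ?(valP x1)//.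
  by apply/asboolP; exists (1 ^+ 2) => N; apply: close => //; exact: ler01.
apply/cvg_ex; exists (Sub f fl2 : l2);
  apply/fcvgrPdist_lt => _ /pos_complexP[e e0 ->].
have e30 : 0 < e / 3 by lra.
have [x Fx] := Fc _ e30; apply: filterS (Fx) => u /= xu.
have fx : `|x - Sub f fl2| <= ((e / 3)%:C)%C.
  by apply: l2_norm_le_re_dot => [|N]; [exact: ltW | apply: close => //;
    exact: ltW].
rewrite -(subrKA x); apply: le_lt_trans (ler_normD _ _) _.
rewrite distrC; apply: le_lt_trans (lerD fx xu) _.
by rewrite -rmorphD ltcR; lra.
Qed.

HB.instance Definition _ := Uniform_isComplete.Build l2 l2_complete.

Definition l2_hilbert : hilbertSpace R := @HilbertSpace R l2 l2_dot l2_normE.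

Definition finsupp (f : T -> R[i]) : Prop :=
  exists s : seq T, forall t, t \notin s -> f t = 0.

Lemma big_prefix_of (V : nmodType) N (s : seq T) (F : T -> V) : uniq s ->
  {subset s <= prefix_of N} -> (forall t, t \notin s -> F t = 0) ->
  \sum_(t <- prefix_of N) F t = \sum_(t <- s) F t.
Proof.
move=> us sN F0;
  rewrite (bigID (mem s)) /= [X in _ + X]big1 ?addr0 => [|t /F0//].
rewrite -big_filter; apply: perm_big; apply: uniq_perm => //.
  by rewrite filter_uniq ?uniq_prefix_of.
by move=> t; rewrite mem_filter andb_idr//; exact: sN.
Qed.

Lemma sub_prefix_of (s : seq T) :
  exists N, forall M, (N <= M)%N -> {subset s <= prefix_of M}.
Proof.
exists (\max_(t <- s) (pickle t).+1) => M NM t ts; apply: mem_prefix_of.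
by apply: leq_trans NM; rewrite (big_rem t)//= leq_maxl.
Qed.

Lemma prefix_of_le N M : (N <= M)%N -> exists s, prefix_of M = prefix_of N ++ s.
Proof.
move=> /subnK <-; elim: (M - N)%N => [|k [s IH]]; first by exists [::];
  rewrite cats0.
by have [s' ->] := prefix_ofS (k + N); rewrite IH; exists (s ++ s');
  rewrite catA.
Qed.

Lemma finsupp_l2 f : finsupp f -> f \in l2_pred.
Proof.
move=> [s fs]; have [N sN] := sub_prefix_of s; apply/asboolP.
exists (re_dot N f f) => M; apply: le_trans (re_dot_homo f (leq_maxl M N)) _.
rewrite /re_dot !(@big_prefix_of _ _ (undup s)) ?undup_uniq// => t.
- by rewrite mem_undup; exact: sN.
- by rewrite mem_undup => /fs -> /=; rewrite !mul0r addr0.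
- by rewrite mem_undup; apply: sN; exact: leq_maxr.
- by rewrite mem_undup => /fs -> /=; rewrite !mul0r addr0.
Qed.

Lemma l2_dot_finsupp (f g : l2) (s : seq T) : uniq s ->
  (forall t, t \notin s -> val f t = 0) ->
  l2_dot f g = \sum_(t <- s) val f t * (val g t)^*.
Proof.
move=> us fs; have [N sN] := sub_prefix_of s.
have re (h : l2) : l2_re_dot f h =
    \sum_(t <- s) (Re (val f t) * Re (val h t) + Im (val f t) * Im (val h t)).
  apply: cvg_lim; first exact: Rhausdorff.
  apply: cvg_near_cst; exists N => // M /= NM.
  by apply: big_prefix_of => // [|t /fs ->]; [exact: sN | rewrite !mul0r addr0].
rewrite /l2_dot !re; apply/eqP; rewrite eq_complex !raddf_sum /=.
apply/andP; split; apply/eqP; apply: eq_bigr => t _;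
  rewrite ?fctE /GRing.scale /=;
  by case: (\val f t) (\val g t) => [a b] [c d] /=; ring.
Qed.

Lemma dense_finsupp : dense [set f : l2 | finsupp (val f)].
Proof.
move=> O [f Of] oO;
  have /nbhs_ballP[_ /pos_complexP[e e0 ->] eO] := open_nbhs_nbhs (conj oO Of).
have [N Ne] : exists N, l2_re_dot f f - re_dot N (val f) (val f) <= (e / 2) ^+
  2.
  have e2 : 0 < (e / 2) ^+ 2 by rewrite exprn_gt0//; lra.
  have /cvgrPdist_le/(_ _ e2)[N _ /(_ N (leqnn N)) /= fN] := @cvg_re_dot f f.
  (* The approximant is [f] cut off to this prefix; its squared distance from [f] is the tail just
     bounded. *)
  by exists N; apply: le_trans (ler_norm _) fN.
pose h t := if t \in prefix_of N then val f t else 0.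
have hs : finsupp h by exists (prefix_of N) => t /negbTE tN; rewrite /h tN.
exists (Sub h (finsupp_l2 hs)); split=> //; apply: eO; rewrite -ball_normE /=.
have e20 : 0 <= e / 2 by lra.
apply: (@le_lt_trans _ _ (((e / 2)%:C)%C)); last by rewrite ltcR; lra.
apply: l2_norm_le_re_dot => // M; apply: le_trans Ne; rewrite lerBrDr.
(* On a prefix containing that of [N], the cut-off and the remainder have disjoint supports and
   their squared norms add up. *)
apply: le_trans (lerD (re_dot_homo _ (leq_maxl M N)) (lexx _)) _.
apply: le_trans (re_dot_le (maxn M N) f); rewrite le_eqVlt; apply/orP; left.
have := uniq_prefix_of (maxn M N); rewrite /re_dot.
have [s ->] := prefix_of_le (leq_maxr M N);
  rewrite cat_uniq => /and3P[_ /hasPn sN _].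
rewrite !big_cat /= [X in X + _ + _]big1_seq => [|t /= tN]; last first.
  by rewrite !fctE /h tN subrr /= mul0r addr0.
rewrite add0r addrC; apply/eqP; congr (_ + _); apply: eq_big_seq => t /sN.
by rewrite !fctE /h /= => /negbTE ->; rewrite subr0.
Qed.

End SquareSummable.

(** * The oscillator representation *)

Section Oscillators.
Variables (R : realType) (q kappa : R) (al : nat -> R) (f g : nat -> nat -> R).
Local Notation C x := ((x)%:C)%C.
Local Notation d := (q - q^-1).
Local Notation V := (nat * nat -> R[i]).

(** The eigenvalue [kappa q^(2(i - j))] of [K] on the basis vector at [(i, j)]; both summands of [E]
    raise [i - j] by one. *)
Definition weight (i j : nat) : R := kappa * q ^+ i.*2 / q ^+ j.*2.

(* The junk value [0.-1 = 0] is harmless: [al 0 = 0]. *)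
Definition opE (u : V) : V := fun t =>
  C (al t.1 * f t.1.-1 t.2) * u (t.1.-1, t.2) +
  C (al t.2.+1 * g t.1 t.2.+1) * u (t.1, t.2.+1).

Definition opE_adj (u : V) : V := fun t =>
  C (al t.1.+1 * f t.1 t.2) * u (t.1.+1, t.2) +
  C (al t.2 * g t.1 t.2) * u (t.1, t.2.-1).

Definition opK (u : V) : V := fun t => C (weight t.1 t.2) * u t.
Definition opKi (u : V) : V := fun t => C (weight t.1 t.2)^-1 * u t.
Definition opF (u : V) : V := opE_adj (opKi u).

(** Terms act directly as maps on families; [op_eval_eq] makes the action descend to the quotient
    algebra. *)
Fixpoint op_eval (t : uq_term R[i]) : V -> V :=
  match t with
  | TE => opE | TF => opF | TK => opK | TKi => opKi
  | TConst a => fun u => a *: u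
  | TAdd s t => fun u => op_eval s u + op_eval t u
  | TMul s t => fun u => op_eval s (op_eval t u)
  end.

Hypotheses (q0 : q != 0) (d0 : q * q - 1 != 0) (kappa0 : kappa != 0).
Hypothesis al0 : al 0%N = 0.
(** The relation for [E F - F E] splits by matrix entries: [offdiag] cancels the terms that move
    both indices, and [diag] matches the diagonal ones. *)
Hypothesis offdiag : forall i j,
  f i j * g i.+1 j.+1 = q ^+ 2 * (g i j.+1 * f i j.+1).
Hypothesis diag : forall i j,
  q ^+ 2 * ((al i * f i.-1 j) ^+ 2 + (al j.+1 * g i j.+1) ^+ 2) -
  ((al i.+1 * f i j) ^+ 2 + (al j * g i j) ^+ 2) =
  q ^+ 2 * (weight i j ^+ 2 - 1) / d.

Lemma weight_neq0 i j : weight i j != 0.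
Proof. by rewrite !mulf_neq0 ?invr_neq0 ?expf_neq0. Qed.

Lemma weightSl i j : weight i.+1 j = q ^+ 2 * weight i j.
Proof. by rewrite /weight doubleS !exprS expr0; ring. Qed.

Lemma weightSr i j : weight i j = q ^+ 2 * weight i j.+1.
Proof.
rewrite /weight doubleS !exprS expr0; field.
by rewrite q0 expf_neq0.
Qed.

Lemma opKKi u : opK (opKi u) = u.
Proof.
by apply/funext => t;
  rewrite /opK /opKi mulrA -rmorphM mulfV ?weight_neq0// mul1r.
Qed.

Lemma opKiK u : opKi (opK u) = u.
Proof.
by apply/funext => t;
  rewrite /opK /opKi mulrA -rmorphM mulVf ?weight_neq0// mul1r.
Qed.

Lemma opKE u : opK (opE (opKi u)) = C (q ^+ 2) *: opE u.
Proof.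
apply/funext => -[i j]; rewrite /opK /opE /opKi /= fctE /GRing.scale /=.
rewrite !mulrDr !mulrA -!rmorphM (weightSr i j) /=; congr (C _ * _ + C _ * _).
  case: i => [|i]; first by rewrite al0 !(mul0r, mulr0).
  by rewrite (weightSl i) /=; have := weight_neq0 i j.+1;
    rewrite (weightSr i j) => w0; field; rewrite w0.
by have w0 := weight_neq0 i j.+1; field.
Qed.

Lemma opKF u : opK (opF (opKi u)) = C (q ^- 2) *: opF u.
Proof.
apply/funext => -[i j];
  rewrite /opK /opF /opE_adj /opKi /= fctE /GRing.scale /=.
rewrite !mulrDr !mulrA -!rmorphM; congr (C _ * _ + C _ * _).
  by have w0 := weight_neq0 i j; rewrite weightSl; field; rewrite w0.
case: j => [|j]; first by rewrite al0 !(mul0r, mulr0).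
by have w0 := weight_neq0 i j.+1; rewrite (weightSr i j) /=; field; rewrite w0.
Qed.

Lemma opEF u : opE (opF u) - opF (opE u) = C d^-1 *: (opK u - opKi u).
Proof.
apply/funext => -[i j]; rewrite /opF /opE_adj /opE /opK /opKi.
rewrite !fctE /GRing.scale /=.
have w0 := weight_neq0 i j.
transitivity (C ((weight i j)^-1 / q ^+ 2 * (q ^+ 2 * ((al i * f i.-1 j) ^+ 2 +
  (al j.+1 * g i j.+1) ^+ 2) -
  ((al i.+1 * f i j) ^+ 2 + (al j * g i j) ^+ 2))) * u (i, j)); last first.
  rewrite diag -mulrBl [RHS]mulrA -rmorphB -rmorphM; congr (C _ * _).
  by field; rewrite w0 q0.
(* [T1] and [T6] are diagonal terms in which a predecessor is followed by a successor; at index 0,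
   where the two do not cancel, [al 0 = 0] removes the term. *)
have T1 : C (al i * f i.-1 j) * (C (al i.-1.+1 * f i.-1 j) *
    (C (weight i.-1.+1 j)^-1 * u (i.-1.+1, j))) =
    C ((al i * f i.-1 j) ^+ 2 / weight i j) * u (i, j).
  case: i {w0} => [|i] /=.
    by rewrite al0 !(mul0r, expr0n).
  by rewrite !mulrA -!rmorphM; congr (C _ * _); ring.
have T6 : C (al j * g i j) * (C (weight i j.-1)^-1 *
    (C (al j.-1.+1 * g i j.-1.+1) * u (i, j.-1.+1))) =
    C ((al j * g i j) ^+ 2 / (q ^+ 2 * weight i j)) * u (i, j).
  case: j {w0 T1} => [|j] /=.
    by rewrite al0 !(mul0r, expr0n).
  rewrite ![in LHS]mulrA -!rmorphM; congr (C _ * _).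
  by have w0 := weight_neq0 i j.+1; rewrite (weightSr i j); field;
    rewrite w0 q0.
(* [T2] and [T3] match the terms of [E F] and [F E] that raise, respectively lower, both indices. *)
have T2 : C (al i * f i.-1 j) * (C (al j * g i.-1 j) *
    (C (weight i.-1 j.-1)^-1 * u (i.-1, j.-1))) =
  C (al j * g i j) * (C (weight i j.-1)^-1 *
    (C (al i * f i.-1 j.-1) * u (i.-1, j.-1))).
  case: i {w0 T1 T6} => [|i] /=; first by rewrite al0 !(mul0r, mulr0).
  case: j => [|j] /=; first by rewrite al0 !(mul0r, mulr0).
  rewrite !mulrA -!rmorphM; congr (C _ * _); rewrite weightSl.
  have w0 := weight_neq0 i j; have off := offdiag i j.
  transitivity (al i.+1 * al j.+1 * (f i j * g i.+1 j.+1) / (q ^+ 2 * weight i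
    j)).
    by rewrite off; field; rewrite q0 w0.
  by field; rewrite q0 w0.
have T3 : C (al j.+1 * g i j.+1) * (C (al i.+1 * f i j.+1) *
    (C (weight i.+1 j.+1)^-1 * u (i.+1, j.+1))) =
  C (al i.+1 * f i j) * (C (weight i.+1 j)^-1 *
    (C (al j.+1 * g i.+1 j.+1) * u (i.+1, j.+1))).
  rewrite !mulrA -!rmorphM; congr (C _ * _); rewrite (weightSr i.+1 j).
  have w1 := weight_neq0 i.+1 j.+1; have off := offdiag i j.
  transitivity (al i.+1 * al j.+1 * (f i j * g i.+1 j.+1) /
      (q ^+ 2 * weight i.+1 j.+1)); last by field; rewrite q0 w1.
  by rewrite off; field; rewrite q0 w1.
rewrite !mulrDr T1 T2 T3 T6 weightSl; field.
by rewrite !fmorph_eq0 q0 w0 weight_neq0.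
Qed.

Lemma op_evalP t (a : R[i]) u v :
  op_eval t (a *: u + v) = a *: op_eval t u + op_eval t v.
Proof.
have PE u' v' : opE (a *: u' + v') = a *: opE u' + opE v'.
  by apply/funext => s; rewrite /opE !fctE /GRing.scale /=; ring.
have PKi u' v' : opKi (a *: u' + v') = a *: opKi u' + opKi v'.
  by apply/funext => s; rewrite /opKi !fctE /GRing.scale /=; ring.
elim: t u v => //= [u v|u v|b u v|s IHs t IHt u v|s IHs t IHt u v].
- by rewrite /opF PKi; apply/funext => s;
  rewrite /opE_adj !fctE /GRing.scale /=; ring.
- by apply/funext => s; rewrite /opK !fctE /GRing.scale /=; ring.
- by rewrite scalerDr !scalerA mulrC.
- by rewrite IHs IHt scalerDr addrACA.
- by rewrite IHt IHs.
Qed.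

Lemma op_evalD t u v : op_eval t (u + v) = op_eval t u + op_eval t v.
Proof. by have := op_evalP t 1 u v; rewrite !scale1r. Qed.

Lemma op_evalZ t (a : R[i]) u : op_eval t (a *: u) = a *: op_eval t u.
Proof.
have := op_evalP t a u 0; rewrite addr0 => ->.
have := op_evalP t 1 0 0; rewrite scaler0 addr0 scale1r => /esym/eqP.
by rewrite -subr_eq0 addrK => /eqP ->; rewrite addr0.
Qed.

Lemma op_eval_eq s t : uq_eq q s t -> op_eval s =1 op_eval t.
Proof.
elim=> //= {s t}.
- by move=> s t _ st u; rewrite st.
- by move=> s t u _ st _ tu v; rewrite st tu.
- by move=> s s' t t' _ ss' _ tt' u; rewrite ss' tt'.
- by move=> s s' t t' _ ss' _ tt' u; rewrite tt' ss'.
- by move=> s t v u; rewrite addrA.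
- by move=> s t u; rewrite addrC.
- by move=> t u; rewrite scale0r add0r.
- by move=> t u; rewrite !scale0r.
- by move=> t u; rewrite scale1r.
- by move=> s t v u; exact: op_evalD.
- by move=> a b u; rewrite scalerDl.
- by move=> a b u; rewrite scalerA.
- by move=> a t u; rewrite op_evalZ.
- by move=> u; rewrite opKKi scale1r.
- by move=> u; rewrite opKiK scale1r.
- exact: opKE.
- exact: opKF.
- move=> u; rewrite !scaleN1r; exact: opEF.
Qed.

(** Finite support is measured by the total degree [i + j], which [E] and [F] change by one and [K]
    preserves. *)
Definition bounded_supp (u : V) :=
  exists N, forall i j, (N <= i + j)%N -> u (i, j) = 0.

Lemma bounded_suppP (u : V) : bounded_supp u <-> finsupp u.
Proof.
split=> [[N uN]|[s us]].
  exists [seq (i, j) | i <- iota 0 N, j <- iota 0 N] => -[i j].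
  move=> /allpairsPdep ij; apply: uN; rewrite leqNgt; apply/negP => ijN;
    apply: ij.
  exists i, j; rewrite !mem_iota !add0n !leq0n /=; split=> //.
    exact: leq_ltn_trans (leq_addr _ _) ijN.
  exact: leq_ltn_trans (leq_addl _ _) ijN.
exists (\max_(t <- s) (t.1 + t.2).+1) => i j ij; apply: us; apply/negP => ijs.
by move: ij; rewrite (big_rem _ ijs) /= geq_max ltnn.
Qed.

Lemma op_eval_bounded t u : bounded_supp u -> bounded_supp (op_eval t u).
Proof.
have bKi v : bounded_supp v -> bounded_supp (opKi v).
  by move=> [N vN]; exists N => i j ij; rewrite /opKi /= vN// mulr0.
elim: t u => [||||a|s IHs t IHt|s IHs t IHt] u /=.
- move=> [N uN]; exists N.+1 => i j ij;
  rewrite /opE /= (uN i j.+1) ?mulr0 ?addr0.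
    case: i ij => [|i] ij; first by rewrite al0 !(mul0r, mulr0).
    by rewrite uN ?mulr0.
  by rewrite addnS; apply: leqW; apply: ltnW.
- move=> /bKi [N uN]; exists N.+1 => i j ij;
  rewrite /opF /opE_adj /= (uN i.+1 j) ?mulr0 ?add0r.
    case: j ij => [|j] ij; first by rewrite al0 !(mul0r, mulr0).
    by rewrite uN ?mulr0// -ltnS -addnS.
  by rewrite addSn; apply: leqW; apply: ltnW.
- by move=> [N uN]; exists N => i j ij; rewrite /opK /= uN// mulr0.
- exact: bKi.
- by move=> [N uN]; exists N => i j ij; rewrite fctE uN// scaler0.
- move=> bu; have [[N uN] [M uM]] := (IHs _ bu, IHt _ bu).
  exists (maxn N M) => i j; rewrite geq_max => /andP[ijN ijM].
  by rewrite fctE uN// uM// addr0.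
- by move=> bu; apply/IHs/IHt.
Qed.

(** For finitely supported vectors and large [N] this is the inner product; the square shape permits
    shifting one index at a time. *)
Definition box_dot N (u v : V) : R[i] :=
  \sum_(i < N) \sum_(j < N) u (i : nat, j : nat) * (v (i : nat, j : nat))^*.

Lemma conj_realM (x : R) (z : R[i]) : (C x * z)^* = C x * z^*.
Proof. by rewrite [LHS]rmorphM /= conj_realC. Qed.

Lemma box_dotC N u v : box_dot N u v = (box_dot N v u)^*.
Proof.
rewrite /box_dot rmorph_sum; apply: eq_bigr => i _; rewrite rmorph_sum.
by apply: eq_bigr => j _; rewrite rmorphM /= conjCK mulrC.
Qed.

(** Each half of [E] is moved across by shifting a summation index. Of the boundary terms, those at
    index 0 vanish by [al 0 = 0] and those at the far edge by the support of [u]. *)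
Lemma box_dot_opE N u v : (forall i j, (N <= i + j)%N -> u (i, j) = 0) ->
  (forall i j, (N <= i + j)%N -> v (i, j) = 0) ->
  box_dot N.+1 (opE u) v = box_dot N.+1 u (opE_adj v).
Proof.
move=> uN vN; rewrite /box_dot /opE /opE_adj /=.
transitivity
  (\sum_(i < N.+1) \sum_(j < N.+1)
     C (al i * f i.-1 j) * u (i.-1, j : nat) * (v (i : nat, j : nat))^* +
   \sum_(i < N.+1) \sum_(j < N.+1)
     C (al j.+1 * g i j.+1) * u (i : nat, j.+1) * (v (i : nat, j : nat))^*).
  rewrite -big_split; apply: eq_bigr => i _; rewrite -big_split.
  by apply: eq_bigr => j _; rewrite /= mulrDl.
transitivity
  (\sum_(i < N.+1) \sum_(j < N.+1)
     u (i : nat, j : nat) * (C (al i.+1 * f i j) * v (i.+1, j : nat))^* +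
   \sum_(i < N.+1) \sum_(j < N.+1)
     u (i : nat, j : nat) * (C (al j * g i j) * v (i : nat, j.-1))^*);
       last first.
  rewrite -big_split; apply: eq_bigr => i _; rewrite -big_split.
  by apply: eq_bigr => j _; rewrite /= -mulrDr -rmorphD.
congr (_ + _).
  rewrite [LHS]big_ord_recl [RHS]big_ord_recr /= [X in X + _]big1 ?add0r => [|j
    _]; last first.
    by rewrite al0 !mul0r.
  rewrite [X in _ = _ + X]big1 ?addr0 => [|j _];
    last by rewrite uN ?leq_addr// mul0r.
  apply: eq_bigr => i _; apply: eq_bigr => j _; rewrite /= conj_realM.
  by rewrite mulrCA mulrA.
apply: eq_bigr => i _;
  rewrite [LHS]big_ord_recr [RHS]big_ord_recl /= al0 !mul0r.
rewrite rmorph0 mulr0 add0r uN ?mulr0 ?mul0r ?addr0; last first.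
  by rewrite addnS; apply: leqW; exact: leq_addl.
by apply: eq_bigr => j _; rewrite /= conj_realM mulrCA mulrA.
Qed.

Lemma box_dot_star t u v : bounded_supp u -> bounded_supp v -> exists N,
  forall M, (N <= M)%N ->
  box_dot M (op_eval t u) v = box_dot M u (op_eval (term_star t) v).
Proof.
have adj x y : bounded_supp x -> bounded_supp y -> exists N,
    forall M, (N <= M)%N -> box_dot M (opE x) y = box_dot M x (opE_adj y).
  move=> [N1 xN] [N2 yN]; exists (maxn N1 N2).+1 => -[//|M] M12.
  apply: box_dot_opE => i j ij; [apply: xN | apply: yN]; apply: leq_trans ij.
    exact: leq_trans (leq_maxl _ _) M12.
  exact: leq_trans (leq_maxr _ _) M12.
have dK M x y : box_dot M (opK x) y = box_dot M x (opK y).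
  apply: eq_bigr => i _; apply: eq_bigr => j _.
  by rewrite /opK conj_realM mulrCA mulrA.
have dKi M x y : box_dot M (opKi x) y = box_dot M x (opKi y).
  apply: eq_bigr => i _; apply: eq_bigr => j _.
  by rewrite /opKi conj_realM mulrCA mulrA.
elim: t u v => [||||a|s IHs t IHt|s IHs t IHt] u v bu bv.
- have [N H] := adj _ _ bu bv; exists N => M NM /=.
  by rewrite /opF opKiK H.
(* For [F] the adjunction of [E] is applied with the arguments exchanged, by Hermitian symmetry. *)
- have bKu : bounded_supp (opKi u) by exact: (op_eval_bounded TKi).
  have [N H] := adj _ _ bv bKu; exists N => M NM /=.
  by rewrite /opF box_dotC -H// -box_dotC dKi.
- by exists 0%N => M _; exact: dK.
- by exists 0%N => M _; exact: dKi.
- exists 0%N => M _; apply: eq_bigr => i _; apply: eq_bigr => j _.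
  by rewrite /= [in RHS]/GRing.scale /= [X in _ = _ * X]rmorphM /= conjCK
    mulrCA mulrA.
- have [[N H1] [N' H2]] := (IHs _ _ bu bv, IHt _ _ bu bv).
  exists (maxn N N') => M; rewrite geq_max => /andP[/H1 {}H1 /H2 {}H2] /=.
  have DD x y z : box_dot M (x + y) z = box_dot M x z + box_dot M y z.
    rewrite -big_split; apply: eq_bigr => i _; rewrite -big_split.
    by apply: eq_bigr => j _; rewrite !fctE mulrDl.
  by rewrite DD H1 H2 [RHS]box_dotC DD rmorphD /= -!box_dotC.
- have [N H1] := IHs (op_eval t u) v (op_eval_bounded t bu) bv.
  have [N' H2] := IHt u _ bu (op_eval_bounded (term_star s) bv).
  exists (maxn N N') => M; rewrite geq_max => /andP[/H1 {}H1 /H2 {}H2] /=.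
  by rewrite H1 H2.
Qed.

Local Notation H := (l2 R (nat * nat)%type).

Lemma l2_dot_box (u v : H) : bounded_supp (val u) ->
  exists N, forall M, (N <= M)%N -> l2_dot u v = box_dot M (val u) (val v).
Proof.
move=> [N uN]; exists N => M NM.
rewrite (@l2_dot_finsupp _ _ u v [seq (i, j) | i <- iota 0 M, j <- iota 0 M]).
- have -> : iota 0 M = index_iota 0 M by rewrite /index_iota subn0.
  by rewrite big_allpairs_dep big_mkord; apply: eq_bigr => i _;
    rewrite big_mkord.
- by apply: allpairs_uniq; rewrite ?iota_uniq// => -[? ?] [? ?].
move=> -[i j] ijM; apply: uN; rewrite leqNgt; apply: contra ijM => ijN.
apply/allpairsPdep; exists i, j; rewrite !mem_iota !add0n !leq0n /=; split=> //.
  exact: leq_ltn_trans (leq_addr _ _) (leq_trans ijN NM).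
exact: leq_ltn_trans (leq_addl _ _) (leq_trans ijN NM).
Qed.

Definition osc_dom : set (l2_hilbert R (nat * nat)%type) :=
  [set u : H | bounded_supp (val u)].

(** The default 0 is taken only when the image is not square-summable; on [osc_dom] the image has
    finite support. *)
Definition osc_act (x : uq q) (u : H) : H := insubd 0 (op_eval (repr x) (val
  u)).

Lemma osc_act_pi t (u : H) : osc_dom u ->
  val (osc_act (uq_pi q t) u) = op_eval t (val u).
Proof.
move=> Du; have tr := uq_reprP q t.
rewrite insubdK; first exact: (op_eval_eq tr).
by apply: finsupp_l2; apply/bounded_suppP; exact: op_eval_bounded.
Qed.

Lemma osc_act_dom x (u : H) : osc_dom u -> osc_dom (osc_act x u).
Proof.
move=> Du; rewrite /osc_dom /= -[x]reprK -/(uq_pi q (repr x)) osc_act_pi//.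
exact: op_eval_bounded.
Qed.

Lemma osc_dom0 : osc_dom 0.
Proof. by exists 0%N. Qed.

Lemma osc_dom_lin (a : R[i]) (u v : H) :
  osc_dom u -> osc_dom v -> osc_dom (a *: u + v).
Proof.
move=> [N uN] [M vM]; exists (maxn N M) => i j; rewrite geq_max => /andP[iN iM].
by rewrite /= !fctE uN// vM// scaler0 addr0.
Qed.

Lemma osc_dense : dense osc_dom.
Proof.
rewrite (_ : osc_dom = [set u : H | finsupp (val u)]%classic).
  exact: dense_finsupp.
by apply/seteqP; split => u /= /bounded_suppP.
Qed.

Lemma osc_lin x (a : R[i]) (u v : H) : osc_dom u -> osc_dom v ->
  osc_act x (a *: u + v) = a *: osc_act x u + osc_act x v.
Proof.
move=> Du Dv; have [t ->] := uq_surj x; apply: val_inj.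
rewrite osc_act_pi; last exact: osc_dom_lin.
by rewrite op_evalP /= !osc_act_pi.
Qed.

Lemma osc_linl (a : R[i]) x y (u : H) : osc_dom u ->
  osc_act (a *: x + y) u = a *: osc_act x u + osc_act y u.
Proof.
move=> Du; have [s ->] := uq_surj x; have [t ->] := uq_surj y.
have -> : a *: uq_pi q s + uq_pi q t = uq_pi q (TAdd (TMul (TConst a) s) t).
  by rewrite uq_piD uq_piM uq_piC -scalerAl mul1r.
by apply: val_inj; rewrite /= !osc_act_pi.
Qed.

Lemma osc1 (u : H) : osc_dom u -> osc_act 1 u = u.
Proof.
move=> Du; apply: val_inj; rewrite -(scale1r (1 : uq q)) -uq_piC osc_act_pi//=.
exact: scale1r.
Qed.

Lemma oscM x y (u : H) : osc_dom u -> osc_act (x * y) u = osc_act x (osc_act y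
  u).
Proof.
move=> Du; have [s ->] := uq_surj x; have [t ->] := uq_surj y.
apply: val_inj; rewrite -uq_piM !osc_act_pi//=.
exact: osc_act_dom.
Qed.

Lemma osc_star x (u v : H) : osc_dom u -> osc_dom v ->
  l2_dot (osc_act x u) v = l2_dot u (osc_act (uq_star x) v).
Proof.
move=> Du Dv; have [t ->] := uq_surj x; rewrite uq_star_pi.
have [N1 H1] := l2_dot_box v (osc_act_dom (uq_pi q t) Du).
have [N2 H2] := l2_dot_box (osc_act (uq_pi q (term_star t)) v) Du.
have [N3 H3] := box_dot_star t Du Dv.
rewrite (H1 (maxn N1 (maxn N2 N3))) ?leq_maxl//.
rewrite (H2 (maxn N1 (maxn N2 N3))); last by rewrite leq_max leq_maxl orbT.
by rewrite !osc_act_pi// H3// !leq_max leqnn !orbT.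
Qed.

Definition osc_rep : starRep (Uq_su2 q) (l2_hilbert R (nat * nat)%type) :=
  @StarRep R (Uq_su2 q) (l2_hilbert R (nat * nat)%type) osc_dom osc_act
    osc_dom0 osc_dom_lin osc_dense osc_act_dom osc_lin osc_linl osc1 oscM
      osc_star.

Lemma finsupp_vacuum : finsupp (fun t : nat * nat => (t == (0%N, 0%N))%:R :
  R[i]).
Proof. by exists [:: (0%N, 0%N)] => t; rewrite inE => /negbTE ->. Qed.

Definition vacuum : H :=
  @Sub _ _ H (fun t => (t == (0%N, 0%N))%:R) (finsupp_l2 finsupp_vacuum).

Lemma osc_dom_vacuum : osc_dom vacuum.
Proof. exact/bounded_suppP/finsupp_vacuum. Qed.

Lemma vacuum_neq0 : vacuum != 0.
Proof.
apply/eqP => /(congr1 val) /(congr1 (fun h => h (0%N, 0%N))) /eqP.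
by rewrite /= oner_eq0.
Qed.

Lemma osc_gap_vacuum : osc_rep ((uqK q - 1) * (uqK q - C q *: 1) : uq q) vacuum
  =
  C ((kappa - 1) * (kappa - q)) *: vacuum.
Proof.
have -> : (uqK q - 1) * (uqK q - C q *: 1) = uq_pi q (TMul
    (TAdd TK (TConst (- 1))) (TAdd TK (TConst (- C q)))).
  by rewrite uq_piM !uq_piD !uq_piC !scaleNr scale1r.
apply: val_inj; rewrite osc_act_pi /=; last exact: osc_dom_vacuum.
apply/funext => t; rewrite /opK !fctE /GRing.scale /=.
have [->|] := eqVneq t (0%N, 0%N); last by rewrite !(mulr0, addr0).
by rewrite /= /weight expr0 divr1 !mulr1 rmorphM !rmorphB; ring.
Qed.

End Oscillators.

(* For p = max(q, 1/q)^2 the coefficients come from the factorizations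
   [J_n - x_n = L^* L] of the Jacobi matrices of the Al-Salam-Chihara polynomials
   in base p > 1, with n = i - j. *)
Lemma oscillator_coefs (R : realType) (q kappa : R) : 0 < q -> q != 1 ->
  exists (al : nat -> R) (f g : nat -> nat -> R),
  [/\ al 0%N = 0,
      forall i j, f i j * g i.+1 j.+1 = q ^+ 2 * (g i j.+1 * f i j.+1)
    & forall i j,
      q ^+ 2 * ((al i * f i.-1 j) ^+ 2 + (al j.+1 * g i j.+1) ^+ 2) -
      ((al i.+1 * f i j) ^+ 2 + (al j * g i j) ^+ 2) =
      q ^+ 2 * (weight q kappa i j ^+ 2 - 1) / (q - q^-1)].
Proof.
move=> q0 q1; have qn0 : q != 0 by rewrite gt_eqF.
have qq1 := sqr_sub1_neq0 q0 q1.
(* Only [c ^+ 2] enters [diag]; this value normalizes the right-hand side. *)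
have [c c2] : exists c, c ^+ 2 = q / (q - q^-1) ^+ 2.
  by exists (Num.sqrt q / (q - q^-1)); rewrite exprMn exprVn sqr_sqrtr ?ltW.
have wS := weightSl q kappa; have wSr i j := weightSr kappa qn0 i j.
pose al (p : R) n := Num.sqrt (p ^+ n - 1).
have al0 p : al p 0%N = 0 by rewrite /al expr0 subrr sqrtr0.
have al2 p n : 1 < p -> al p n ^+ 2 = p ^+ n - 1.
  by move=> p1; rewrite sqr_sqrtr// subr_ge0 exprn_ege1// ltW.
(* The base is whichever of [q ^- 2] and [q ^+ 2] exceeds 1, so that [p ^+ n - 1] has a real square
   root. The weight is put into [f] when [q < 1] and into [g] when [q > 1]. *)
move: (q1); rewrite neq_lt => /orP[q_lt1|q_gt1].
  exists (al (q ^- 2)), (fun i j => c * (q * weight q kappa i j)), (fun _ _ =>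
    c).
  split=> // i j; first by rewrite (wSr i j); ring.
  have p1 : 1 < q ^- 2 by rewrite invf_gt1 ?exprn_gt0// exprn_ilt1 ?ltW.
  have -> : (al (q ^- 2) i * (c * (q * weight q kappa i.-1 j))) ^+ 2 =
      (q ^- 2 ^+ i - 1) * (c ^+ 2 * (weight q kappa i j / q) ^+ 2).
    rewrite exprMn al2//; case: i => [|i] /=;
      first by rewrite expr0 subrr !mul0r.
    by rewrite wS; field.
  rewrite !(exprMn 2 (al _ _)) (exprMn 2 c) !al2// c2 !(exprS (q ^- 2)).
  move: (q ^- 2 ^+ i) (q ^- 2 ^+ j) (weight _ _ _ _) => x y z.
  by field; rewrite qn0 qq1.
exists (al (q ^+ 2)), (fun _ _ => c), (fun i j => c * (q * weight q kappa i j)).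
split=> // i j; first by rewrite wS; ring.
have p1 : 1 < q ^+ 2 by rewrite exprn_egt1.
rewrite !(exprMn 2 (al _ _)) !(exprMn 2 c) !al2// c2 !(exprS (q ^+ 2)) (wSr i
  j).
move: (q ^+ 2 ^+ i) (q ^+ 2 ^+ j) (weight _ _ _ _) => x y z.
by field; rewrite qn0 qq1.
Qed.

Theorem theorem4p5 (R : realType) (q : R) (hq0 : 0 < q) (hq1 : q != 1) :
  exists (H : hilbertSpace R) (pi : starRep (Uq_su2 q) H),
    ~ exists (K : hilbertSpace R) (J : {linear H -> K})
             (rho : starRep (Uq_su2 q) K),
        [/\ forall u v : H, hdot K (J u) (J v) = hdot H u v,
            well_behaved rho
          & rep_extends J pi rho].
Proof.
have qn0 : q != 0 by rewrite gt_eqF.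
have qq1 := sqr_sub1_neq0 hq0 hq1.
(* The midpoint lies strictly between 1 and [q], where no positive character takes its value on
   [K]. *)
pose kappa := (1 + q) / 2.
have kappa0 : kappa != 0 by rewrite gt_eqF// /kappa; lra.
have [al [f [g [al0 offdiag diag]]]] := oscillator_coefs kappa hq0 hq1.
exists _, (osc_rep qn0 qq1 kappa0 al0 offdiag diag).
move=> [K [J [rho [isoJ rho_wb ext]]]].
have [DJ rhoJ] := ext _ (osc_dom_vacuum R).
have c0 : (kappa - 1) * (kappa - q) < 0.
  have -> : (kappa - 1) * (kappa - q) = - ((q - 1) / 2) ^+ 2 by rewrite /kappa;
    field.
  by rewrite oppr_lt0 exprn_even_gt0//= mulf_neq0 ?invr_neq0 ?subr_eq0.
have rho_b : rho (val ((baseK q - 1) * (baseK q - (q%:C)%C *: 1))) (J (vacuum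
  R)) =
    (((kappa - 1) * (kappa - q))%:C)%C *: J (vacuum R).
  by rewrite rhoJ osc_gap_vacuum linearZ.
have J0 := well_behaved_eigen_eq0 (Bhat_pos_gap hq0 hq1) c0 rho_wb DJ rho_b.
(* The isometry [J] cannot send the nonzero vacuum to 0. *)
have := isoJ (vacuum R) (vacuum R); rewrite J0 linear0l => /esym/eqP.
by rewrite dnorm_eq0 (negbTE (vacuum_neq0 R)).
Qed.
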